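(* Let $x,b>0$ and $a_1,\dots,a_5>0$ satisfy $a_1+a_4>1$, $a_2+a_5>1$, $a_2+a_3>1$, $a_3+a_4>1$, $a_4+a_5>1$. Fix $\mathcal{U}^0=(\mathcal{U}^0_2,\mathcal{U}^0_4)$ and $\mathcal{W}^0=(\mathcal{W}^0_2,\mathcal{W}^0_4)$ in $\mathbb{R}_+^2$, and let $\{\mathcal{U}^t\}$, $\{\mathcal{W}^t\}$ be copies, started at $\mathcal{U}^0$ and $\mathcal{W}^0$ respectively, of the Markov chain on $\mathbb{R}_+^2$ given by $(u_2^{t+1},u_4^{t+1})=F^{t+1}(u_2^t,u_4^t)$ (defined in the context). Put $M=\max\{\mathcal{U}_2^0,\mathcal{U}_4^0,\mathcal{W}_2^0,\mathcal{W}_4^0\}$, $m=\min\{\mathcal{U}_2^0,\mathcal{U}_4^0,\mathcal{W}_2^0,\mathcal{W}_4^0\}$, $R_0=M/m$, $J_0=2m+\frac{1}{2m}$. Let $\eta,r,\beta,d$ be the constants defined in the context. If $J_0\le\eta$, then for every integer $t>0$, $$d_{TV}(\mathcal{U}^{t+3},\mathcal{W}^{t+3})\le 3\,r^{t/(2d)}(a_2+a_3+a_4+a_5)(R_0-1).$$ For general values of $J_0$, for every integer $t>0$, $$d_{TV}(\mathcal{U}^{t+3},\mathcal{W}^{t+3})\le 3\,r^{t/(4d)}(a_2+a_3+a_4+a_5)(R_0-1)+\frac{\max\{J_0,\eta\}}{\eta}\,\beta^{\lfloor t/2\rfloor+3}.$$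
   Context: $\mathbb{R}_+=(0,\infty)$. $\Gamma(\alpha,\lambda)$ is the Gamma distribution with shape $\alpha$ and inverse scale (rate) $\lambda$, with density $\frac{\lambda^\alpha}{\Gamma(\alpha)}z^{\alpha-1}e^{-\lambda z}$ on $z>0$. For random variables $X,Y$, $d_{TV}(X,Y)$ is the total variation distance $\sup_A|\mathbb{P}(X\in A)-\mathbb{P}(Y\in A)|$ between their laws (equivalently, the infimum of $\mathbb{P}(X'\ne Y')$ over couplings $(X',Y')$ of the two laws). Let $\{\gamma_i^t: t=1,2,\dots,\ i=1,2,3,4\}$ be independent with $\gamma_i^t\sim\Gamma(a_i+a_{i+1},1)$, and for $t\ge1$ define the random map $F^t:\mathbb{R}_+^2\to\mathbb{R}_+^2$ by $$F^t(u_2,u_4)=\left(\frac{\gamma_2^t}{\frac{\gamma_1^t}{x+u_2}+\frac{\gamma_3^t}{u_2+u_4}},\ \frac{\gamma_4^t}{b+\frac{\gamma_3^t}{u_2+u_4}}\right).$$ Constants. Let $\gamma_1,\dots,\gamma_4$ be independent with $\gamma_i\sim\Gamma(a_i+a_{i+1},1)$, and $$\zeta_1=\frac{a_2+a_3}{a_1+a_2+a_3+a_4-1},\quad \zeta_2=\frac{a_3+a_4}{a_2+a_3+a_4+a_5-1},$$ $$C_1=\zeta_1x+\frac{a_4+a_5}{b},\quad C_2=\frac{a_1+a_2+xb}{x(a_2+a_3+a_4+a_5-1)},\quad \varrho=\frac{4(a_3+a_4)}{a_1+a_2-\frac13},$$ $$\eta=\frac{2(C_1+C_2)}{1-\max\{\zeta_1,\zeta_2\}},\quad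 \beta=\frac{1+\max\{\zeta_1,\zeta_2\}}{2},\quad \theta_1=\frac1x(\varrho+4)\zeta_1,$$ $$\theta_2=\left((\varrho+4)x+\frac{4(a_3+a_4)}{b}\right)\mathbb{E}\left[\left(2+\frac{\gamma_2}{\gamma_4}+\frac{\gamma_4}{\gamma_2}\right)\frac{\gamma_3}{\gamma_2+\gamma_4}\right],$$ $$\theta_3=\frac1x(\varrho+4)\left(\zeta_1x+\frac{a_4+a_5}{b}\right)+\left((\varrho+4)x+\frac{4(a_3+a_4)}{b}\right)\mathbb{E}\left[\left(2+\frac{\gamma_2}{\gamma_4}+\frac{\gamma_4}{\gamma_2}\right)\frac{\frac{\gamma_1}{x}+b}{\gamma_2+\gamma_4}\right],$$ $$r=1-\frac{1}{\eta(\theta_1+\theta_2)+\theta_3},\qquad d=\max\left\{3,\ \frac{\ln\left(\beta\,|\ln\beta|\,\sqrt r/2\right)}{\ln\beta}\right\}.$$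
   Formalization: The condition a_1+a_2>1/3 is added: at a_1+a_2=1/3 the constant ϱ is undefined, and for a_1+a_2<1/3 ϱ is negative and the bound fails for suitable small x, b (e.g. a=(.1,.1,1,1,1), b=κx with 3<κ<4 chosen so that r=1/2). *)

(* Defs.v *)
From HB Require Import structures.
From mathcomp Require Import all_boot all_order all_algebra.
From mathcomp Require Import all_classical all_reals all_analysis.
Import Order.TTheory GRing.Theory Num.Theory.
Import numFieldNormedType.Exports.

Set Implicit Arguments.
Unset Strict Implicit.
Unset Printing Implicit Defensive.

Local Open Scope classical_set_scope.
Local Open Scope ring_scope.

Definition gamma_fun (R : realType) (alpha : R) : R :=
  \int[@lebesgue_measure R]_(z in `]0, +oo[) (z `^ (alpha - 1) * expR (- z)).

(* Shape [alpha], rate (inverse scale) [lambda]. *)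
Definition gamma_pdf (R : realType) (alpha lambda z : R) : R :=
  if 0 < z then
    lambda `^ alpha / gamma_fun alpha * z `^ (alpha - 1) * expR (- (lambda * z))
  else 0.

Definition gamma_distributed d (T : measurableType d) (R : realType)
    (P : probability T R) (X : {RV P >-> R}) (alpha lambda : R) : Prop :=
  forall A : set R, measurable A ->
    distribution P X A =
      (\int[@lebesgue_measure R]_(z in A) (gamma_pdf alpha lambda z)%:E)%E.

(* Mutual independence of the family [(X i)_(i in D)]: the product rule for every
   finite subfamily. *)
Definition mutually_independent d (T : measurableType d) (R : realType)
    (P : probability T R) (I : eqType) (D : {pred I}) (X : I -> {RV P >-> R}) :
    Prop :=
  forall (s : seq I) (A : I -> set R), uniq s -> {subset s <= D} ->
    (forall i, measurable (A i)) ->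
    P (\big[setI/setT]_(i <- s) (X i @^-1` A i)) =
      (\prod_(i <- s) P (X i @^-1` A i))%E.

Definition dTV d (S : measurableType d) (R : realType) (mu nu : set S -> \bar R) :
    \bar R :=
  ereal_sup [set `|mu A - nu A|%E | A in measurable].

(* The parameters [a] and the Gamma variables are indexed from 1, as in
   [a 1, ..., a 5]; their values at other indices are irrelevant. *)
Definition gamma_quadruple d (T : measurableType d) (R : realType)
    (P : probability T R) (a : nat -> R) (g : nat -> {RV P >-> R}) : Prop :=
  (forall i, (1 <= i <= 4)%N -> gamma_distributed (g i) (a i + a i.+1) 1) /\
  mutually_independent [pred i : nat | (1 <= i <= 4)%N] g.

Definition gamma_noise d (T : measurableType d) (R : realType)
    (P : probability T R) (a : nat -> R) (g : nat -> nat -> {RV P >-> R}) : Prop :=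
  (forall t i, (1 <= t)%N -> (1 <= i <= 4)%N ->
     gamma_distributed (g t i) (a i + a i.+1) 1) /\
  mutually_independent [pred k : nat * nat | (1 <= k.1)%N && (1 <= k.2 <= 4)%N]
    (fun k => g k.1 k.2).

(* The states are pairs [(u_2, u_4)]; [g i] is the value of [gamma_i]. *)
Definition step_map (R : realType) (x b : R) (g : nat -> R) (u : R * R) : R * R :=
  (g 2%N / (g 1%N / (x + u.1) + g 3%N / (u.1 + u.2)),
   g 4%N / (b + g 3%N / (u.1 + u.2))).

Definition is_chain d (T : measurableType d) (R : realType) (P : probability T R)
    (x b : R) (g : nat -> nat -> {RV P >-> R}) (u0 : R * R)
    (U : nat -> {RV P >-> (R * R)%type}) : Prop :=
  (forall w, U 0%N w = u0) /\
  (forall t w, U t.+1 w = step_map x b (fun i => g t.+1 i w) (U t w)).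

Section Constants.
Context d (T : measurableType d) (R : realType) (P : probability T R).
Variables (x b : R) (a : nat -> R) (g : nat -> {RV P >-> R}).
Arguments a _%_N.
Arguments g _%_N.

Definition zeta1 : R := (a 2 + a 3) / (a 1 + a 2 + a 3 + a 4 - 1).

Definition zeta2 : R := (a 3 + a 4) / (a 2 + a 3 + a 4 + a 5 - 1).

Definition C1 : R := zeta1 * x + (a 4 + a 5) / b.

Definition C2 : R := (a 1 + a 2 + x * b) / (x * (a 2 + a 3 + a 4 + a 5 - 1)).

(* [alpha - 1/3] is a lower bound for the median of Gamma(alpha, 1), used here
   with [alpha = a 1 + a 2]; the formula is meant for [a 1 + a 2 > 1/3]. *)
Definition varrho : R := 4 * (a 3 + a 4) / (a 1 + a 2 - 1 / 3).

Definition eta_const : R := 2 * (C1 + C2) / (1 - Num.max zeta1 zeta2).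

Definition beta_const : R := (1 + Num.max zeta1 zeta2) / 2.

Definition theta1 : R := 1 / x * (varrho + 4) * zeta1.

Definition theta2 : R :=
  ((varrho + 4) * x + 4 * (a 3 + a 4) / b) *
  fine 'E_P[fun w => (2 + g 2 w / g 4 w + g 4 w / g 2 w) *
                     (g 3 w / (g 2 w + g 4 w))].

Definition theta3 : R :=
  1 / x * (varrho + 4) * (zeta1 * x + (a 4 + a 5) / b) +
  ((varrho + 4) * x + 4 * (a 3 + a 4) / b) *
  fine 'E_P[fun w => (2 + g 2 w / g 4 w + g 4 w / g 2 w) *
                     ((g 1 w / x + b) / (g 2 w + g 4 w))].

Definition rate : R := 1 - 1 / (eta_const * (theta1 + theta2) + theta3).

Definition dconst : R :=
  Num.max 3
    (ln (beta_const * `|ln beta_const| * Num.sqrt rate / 2) / ln beta_const).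

End Constants.

(* Main.v *)
Require Import Defs.
From HB Require Import structures.
From mathcomp Require Import all_boot all_order all_algebra.
From mathcomp Require Import all_classical all_reals all_analysis.
From mathcomp Require Import measurable_realfun.
From mathcomp Require Import ring lra.
Import Order.TTheory GRing.Theory Num.Theory.
Import numFieldNormedType.Exports.
Local Open Scope classical_set_scope.
Local Open Scope ring_scope.

(* Run both chains with the same noise. The map F is increasing and sublinear, so
   two states in [l, r l] are sent into [l', r' l'], where l' is the image of l
   and r' - 1 <= (r - 1) c with c < 1 depending only on l and the noise.
   Averaging c over two steps gives the rate when V(l) <= eta, with
   V = S + 1/S and S = u_2 + u_4; elsewhere V decreases
   on average by beta. The bound (r - 1) lam^n (1 + al V / eta), lam = rate^(1/2d),
   is therefore propagated by the transition kernel. Two states in [l, r l] have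
   one-step laws that both dominate r^(-(a_2 + a_3 + a_4 + a_5)) times the law
   issued from l, because dilating a Gamma(alpha) variable by s >= 1 multiplies
   its density by at least s^(-alpha); this turns ratios into total variation.
   All Gamma computations (moments, inverse moments of sums) come from this same
   dilation identity. *)

Set Implicit Arguments.
Unset Strict Implicit.
Unset Printing Implicit Defensive.

(** * Integration *)

Section Integration.
Context {R : realType}.
Notation leb := (@lebesgue_measure R).
Local Open Scope ereal_scope.

(** The two copies live on unrelated probability spaces, so no coupling of them is built. The kernel
    is realised with the single quadruple [g]; the law of each chain is an iterate of this kernel on
    indicators, and total variation becomes the oscillation of that iterate between two starting
    points. Sharing the noise means comparing two integrals over the same space. The obstacle is
    that c has mean at most 1 - 1/D(l), where D blows up when S tends to 0 or to infinity, so this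
    bound gives no uniform one-step contraction. One step from V <= eta brings the mean of D below Z
    = eta (theta1 + theta2) + theta3, and by convexity the factor of the next step averages to at
    most 1 - 1/Z, which is the rate. Only the second factor of such a pair is exploited. The excess
    weight al beta caused by excursions out of V <= eta must then fit between rate and lam^2 =
    rate^(1/d), with al = (1 - lam)/(lam - beta); [d] is large enough for this. The condition 1/3 <
    a_1 + a_2 makes [varrho] positive. *)

Lemma measurable_inv : measurable_fun [set: R] (@GRing.inv R).
Proof.
(* This reduces the claim to the measurability of [powR]. Both sides vanish at 0, where the inverse
   is 0 by convention. *)
rewrite (_ : @GRing.inv R = fun x => (x * (x ^+ 2) `^ (-1))%R); last first.
  apply/funext => x; rewrite powR_inv1 ?sqr_ge0// -exprVn expr2.
  by have [->|x0] := eqVneq x 0%R; rewrite ?invr0 ?mulr0// mulrA mulfV// mul1r.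
apply: measurable_funM => //.
apply: (measurableT_comp (measurable_powR _)).
exact: measurable_funX.
Qed.

Lemma measurable_funV d (T : measurableType d) (f : T -> R) :
  measurable_fun setT f -> measurable_fun setT (fun x => (f x)^-1%R).
Proof. by move=> mf; apply: (measurableT_comp measurable_inv). Qed.

(** The pushforward of Lebesgue measure by z -> c z, multiplied by c, gives every interval its
    length, so it is Lebesgue measure. *)
Lemma ge0_integral_lebesgue_scale (c : R) (f : R -> \bar R) : (0 < c)%R ->
  measurable_fun setT f -> (forall z, 0 <= f z) ->
  \int[leb]_z f z = c%:E * \int[leb]_z f (c * z)%R.
Proof.
move=> c0 mf f0.
have mc : measurable_fun [set: measurableTypeR R]
    ((fun z => c * z)%R : measurableTypeR R -> measurableTypeR R).
  exact: mulrl_measurable.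
pose c' : {nonneg R} := NngNum (ltW c0).
pose f' := ((fun z => c * z)%R : measurableTypeR R -> measurableTypeR R).
pose m : {measure set (measurableTypeR R) -> \bar R} := mscale c' (pushforward leb f').
have lm A : measurable A -> leb A = m mc A.
  apply: (lebesgue_measure_unique (mu := m mc)) => _ [[a b]] _ <- /=.
  rewrite /m /mscale /= /pushforward.
  have -> : f' @^-1` `]a, b]%classic = `](a / c)%R, (b / c)%R]%classic.
    by apply/seteqP; split => z /=; rewrite !in_itv/= ltr_pdivrMr// ler_pdivlMr// mulrC.
  rewrite !lebesgue_measure_itv/= !lte_fin ltr_pM2r ?invr_gt0//.
  case: ifPn => // _; last by rewrite mule0.
  by rewrite -!EFinB -EFinM -mulrBl mulrC divfK// gt_eqF.
rewrite (eq_measure_integral (m mc)); last by move=> A mA _; exact: lm.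
rewrite ge0_integral_mscale//.
by rewrite ge0_integral_pushforward.
Qed.

(** [p] and the Radon-Nikodym derivative of [mu] have the same integral over every measurable set,
    hence agree almost everywhere; the change of variables for the derivative passes to [p]. *)
Lemma ge0_integral_density d (T : measurableType d)
    (lam : {sigma_finite_measure set T -> \bar R})
    (mu : {finite_measure set T -> \bar R}) (p : T -> R) (f : T -> \bar R) :
  measurable_fun setT p -> (forall z, 0 <= p z)%R ->
  (forall A, measurable A -> mu A = \int[lam]_(z in A) (p z)%:E) ->
  measurable_fun setT f -> (forall z, 0 <= f z) ->
  \int[mu]_z f z = \int[lam]_z (f z * (p z)%:E).
Proof.
move=> mp p0 muE mf f0.
have mpE : measurable_fun setT (EFin \o p) by exact/measurable_EFinP.
have dom : mu `<< lam.
  apply/null_content_dominatesP => A mA A0.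
  by rewrite muE//; apply: null_set_integral => //; exact: measurable_funTS.
have ip : lam.-integrable setT (EFin \o p).
  apply/integrableP; split => //.
  under eq_integral do rewrite /= ger0_norm//.
  by rewrite -muE// ltey_eq fin_num_measure.
rewrite -(Radon_Nikodym_SigmaFinite.change_of_variables dom)//.
apply: ge0_ae_eq_integral => //.
- apply: emeasurable_funM => //.
  exact: measurable_int (Radon_Nikodym_SigmaFinite.f_integrable dom).
- exact: emeasurable_funM.
- by move=> x _; rewrite mule_ge0// Radon_Nikodym_SigmaFinite.f_ge0.
- by move=> x _; rewrite mule_ge0// lee_fin.
apply: ae_eqe_mul2l.
apply: integral_ae_eq => //; first exact: Radon_Nikodym_SigmaFinite.f_integrable.
move=> A _ mA.
rewrite -Radon_Nikodym_SigmaFinite.f_integral//; exact: muE.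
Qed.

Lemma ge0_integral_pdf d (T : measurableType d) (P : probability T R)
    (X : {RV P >-> R}) (p : R -> R) (f : R -> \bar R) :
  measurable_fun setT p -> (forall z, 0 <= p z)%R ->
  (forall A, measurable A ->
    distribution P X A = \int[leb]_(z in A) (p z)%:E) ->
  measurable_fun setT f -> (forall z, 0 <= f z) ->
  \int[P]_w f (X w) = \int[leb]_z (f z * (p z)%:E).
Proof.
move=> mp p0 XE mf f0.
(* [leb] is a measure on the alias [measurableTypeR R], so [X] is repackaged with that codomain. *)
have mX : measurable_fun setT (X : T -> measurableTypeR R).
  exact: (measurable_funP X).
pose mX_mixin := isMeasurableFun.Build _ _ _ _ _ mX.
pose X' : {RV P >-> measurableTypeR R} :=
  HB.pack (X : T -> measurableTypeR R) mX_mixin.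
rewrite -(ge0_integral_density (mu := distribution P X')) //.
by rewrite ge0_integral_distribution.
Qed.

End Integration.

(** * Gamma laws *)

Section Gamma.
Context {R : realType}.
Notation leb := (@lebesgue_measure R).
Local Open Scope ereal_scope.

Lemma gamma_pdf_ge0 (alpha z : R) : (0 <= gamma_pdf alpha 1 z)%R.
Proof.
rewrite /gamma_pdf; case: ifPn => // z0.
rewrite !mulr_ge0 ?powR_ge0 ?expR_ge0// invr_ge0 /gamma_fun.
by apply: Rintegral_ge0 => t _; rewrite mulr_ge0 ?powR_ge0 ?expR_ge0.
Qed.

Lemma measurable_gamma_pdf (alpha : R) : measurable_fun setT (gamma_pdf alpha 1).
Proof.
apply: measurable_fun_ifT => //; first exact: measurable_fun_ltr.
apply: measurable_funM; first exact: measurable_funM.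
apply: measurableT_comp => //.
by apply: measurableT_comp => //; apply: measurable_funM.
Qed.

(** The left side is the density of c X for X of law Gamma(alpha, 1). The normalising constant is
    the same on both sides, so [gamma_fun] is never evaluated. *)
Lemma gamma_pdf_scale (alpha c z : R) : (0 < c)%R ->
  (c^-1 * gamma_pdf alpha 1 (c^-1 * z) =
   c `^ (- alpha) * (expR (z * (1 - c^-1)) * gamma_pdf alpha 1 z))%R.
Proof.
move=> c0; rewrite /gamma_pdf pmulr_rgt0 ?invr_gt0//.
case: ifPn => [z0|_]; last by rewrite !mulr0.
rewrite powRM ?invr_ge0 ?ltW// !mul1r.
have -> : (expR (- (c^-1 * z)) = expR (z * (1 - c^-1)) * expR (- z))%R.
  by rewrite -expRD; congr expR; ring.
have -> : (c^-1 `^ (alpha - 1) = c * c `^ (- alpha))%R.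
  rewrite -powR_inv1 ?ltW// -powRrM mulN1r opprB powRD ?powRr1 ?ltW//.
  by rewrite (gt_eqF c0) implybT.
by move: (_ / _)%R => K; field; rewrite gt_eqF.
Qed.

(* Laws behaving under dilations like Gamma(a, 1), stated without a density so
   that it also covers sums of independent Gamma variables. *)
Definition gamma_scaling d (T : measurableType d) (P : probability T R)
    (X : T -> R) (a : R) :=
  forall (c : R) (h : R -> \bar R), (0 < c)%R ->
  measurable_fun setT h -> (forall z, 0 <= h z) ->
  \int[P]_w h (c * X w)%R =
  (c `^ (- a))%:E * \int[P]_w (h (X w) * (expR (X w * (1 - c^-1)))%:E).

Lemma gamma_distributed_scaling d (T : measurableType d) (P : probability T R)
    (X : {RV P >-> R}) (alpha : R) :
  gamma_distributed X alpha 1 -> gamma_scaling P X alpha.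
Proof.
move=> XE c h c0 mh h0.
have mp := measurable_gamma_pdf alpha; have p0 := gamma_pdf_ge0 alpha.
have mexp : measurable_fun [set: R] (fun z : R => expR (z * (1 - c^-1))).
  by apply: measurableT_comp => //; apply: measurable_funM.
have mc (k : R) : measurable_fun [set: R] (fun z : R => (k * z)%R).
  exact: mulrl_measurable.
rewrite (ge0_integral_pdf (f := fun z => h (c * z)%R) mp p0 XE)//; last first.
  by apply: measurableT_comp.
rewrite (ge0_integral_pdf (f := fun z => h z * (expR (z * (1 - c^-1)))%:E)
  mp p0 XE); last 2 first.
- by apply: emeasurable_funM => //; exact/measurable_EFinP.
- by move=> z; rewrite mule_ge0// lee_fin expR_ge0.
have mpc : measurable_fun [set: R] (fun z => gamma_pdf alpha 1 (c^-1 * z)%R).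
  by apply: measurableT_comp.
have := @ge0_integral_lebesgue_scale R c
  (fun z => h z * (c^-1 * gamma_pdf alpha 1 (c^-1 * z))%:E) c0.
under [X in _ = _ * X]eq_integral => z _.
  rewrite [(c^-1 * (c * z))%R]mulrA mulVf ?gt_eqF// mul1r EFinM muleCA.
  over.
rewrite ge0_integralZl//; last 3 first.
- apply: emeasurable_funM; last exact/measurable_EFinP.
  by apply: measurableT_comp.
- by move=> z _; rewrite mule_ge0// lee_fin.
- by rewrite lee_fin invr_ge0 ltW.
rewrite muleA -EFinM mulfV ?gt_eqF// mul1e => <-; last 2 first.
- apply: emeasurable_funM => //; apply/measurable_EFinP.
  exact: measurable_funM.
- by move=> z; rewrite mule_ge0// lee_fin mulr_ge0// invr_ge0 ltW.
rewrite -ge0_integralZl//; last 3 first.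
- apply: emeasurable_funM; last exact/measurable_EFinP.
  by apply: emeasurable_funM => //; exact/measurable_EFinP.
- by move=> z _; rewrite !mule_ge0// lee_fin// expR_ge0.
- by rewrite lee_fin powR_ge0.
apply: eq_integral => z _.
by rewrite gamma_pdf_scale// -muleA [RHS]muleCA -!EFinM.
Qed.

End Gamma.

(** * Independence *)

Section Independence.
Context {R : realType}.
Local Open Scope ereal_scope.

(** The joint law is a product measure, and Tonelli applies. [X'] may live on another space than
    [X]: this is how the noise of either chain gets replaced by [g]. *)
Lemma ge0_integral_indep d (T : measurableType d) (P : probability T R)
    d' (T' : measurableType d') (P' : probability T' R)
    d1 (S1 : measurableType d1) d2 (S2 : measurableType d2)
    (Y : T -> S1) (X : T -> S2) (X' : T' -> S2) (F : S1 * S2 -> \bar R) :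
  measurable_fun setT Y -> measurable_fun setT X -> measurable_fun setT X' ->
  (forall A B, measurable A -> measurable B ->
    P (Y @^-1` A `&` X @^-1` B) = P (Y @^-1` A) * P' (X' @^-1` B)) ->
  measurable_fun setT F -> (forall z, 0 <= F z) ->
  \int[P]_w F (Y w, X w) = \int[P]_w \int[P']_v F (Y w, X' v).
Proof.
move=> mY mX mX' YX mF F0.
pose mY_mixin := isMeasurableFun.Build _ _ _ _ _ mY.
pose Y1 : {RV P >-> S1} := HB.pack Y mY_mixin.
pose mX'_mixin := isMeasurableFun.Build _ _ _ _ _ mX'.
pose X1 : {RV P' >-> S2} := HB.pack X' mX'_mixin.
have mYX : measurable_fun setT (fun w => (Y w, X w)).
  exact: measurable_fun_pair.
pose mYX_mixin := isMeasurableFun.Build _ _ _ _ _ mYX.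
pose Z : {RV P >-> (S1 * S2)%type} := HB.pack (fun w => (Y w, X w)) mYX_mixin.
transitivity (\int[distribution P Y1 \x distribution P' X1]_z F z).
  rewrite (eq_measure_integral (distribution P Z)).
    by rewrite ge0_integral_distribution.
  by move=> A mA _; apply: product_measure_unique.
rewrite fubini_tonelli1// ge0_integral_distribution.
- apply: eq_integral => w _; rewrite /fubini_F/=.
  rewrite ge0_integral_distribution//;
    exact: measurableT_comp.
- exact: measurable_fun_fubini_tonelli_F.
- by move=> w; exact: integral_ge0.
Qed.


Lemma measure_rectangle_unique d1 (S1 : measurableType d1)
    d2 (S2 : measurableType d2) (m1 m2 : {measure set (S1 * S2) -> \bar R}) :
  (forall A B, measurable A -> measurable B -> m1 (A `*` B) = m2 (A `*` B)) ->
  m1 setT < +oo -> forall Z, measurable Z -> m1 Z = m2 Z.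
Proof.
move=> m12 m1T Z mZ.
pose C : set (set (S1 * S2)) :=
  [set C | exists A, measurable A /\ exists B, measurable B /\ C = A `*` B].
apply: (measure_unique C (fun=> setT)) => //.
- rewrite measurable_prod_measurableType //; congr (<<s _ >>).
  rewrite predeqE; split => [[A mA [B mB <-]]|[A [mA [B [mB ->]]]]].
    by exists A; split => //; exists B.
  by exists A => //; exists B.
- move=> _ _ [A1 [mA1 [A2 [mA2 ->]]]] [B1 [mB1 [B2 [mB2 ->]]]].
  rewrite -setXI; exists (A1 `&` B1); split; first exact: measurableI.
  by exists (A2 `&` B2); split => //; exact: measurableI.
- move=> _; exists setT; split => //; exists setT; split => //.
  by rewrite setXTT.
- exact: bigcup_const.
- by move=> _ [A [mA [B [mB ->]]]]; exact: m12.
Qed.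

(* Independence of Y from the variables indexed by D, in a form that survives
   moving one of these variables into Y. *)
Definition indep_future d (T : measurableType d) (P : probability T R)
    (I : eqType) (X : I -> {RV P >-> R}) (D : {pred I})
    d' (S : measurableType d') (Y : T -> S) : Prop :=
  forall (B : set S) (s : seq I) (A : I -> set R), measurable B ->
    uniq s -> {subset s <= D} -> (forall i, measurable (A i)) ->
    P (Y @^-1` B `&` \big[setI/setT]_(i <- s) (X i @^-1` A i)) =
    P (Y @^-1` B) * \prod_(i <- s) P (X i @^-1` A i).

Section IndepFuture.
Context d (T : measurableType d) (P : probability T R).
Context (I : eqType) (X : I -> {RV P >-> R}).
Context d1 (S1 : measurableType d1) d2 (S2 : measurableType d2).

Let mpre d' (S : measurableType d') (Y : T -> S) (B : set S) :
  measurable_fun setT Y -> measurable B -> measurable (Y @^-1` B).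
Proof. by move=> mY mB; rewrite -[X in measurable X]setTI; exact: mY. Qed.

Lemma indep_future_cst (D : {pred I}) (y : S1) :
  mutually_independent D X -> indep_future X D (fun=> y).
Proof.
move=> iX B s A mB us sD mA; rewrite preimage_cst; case: ifPn => _.
  by rewrite setTI probability_setT mul1e; exact: iX.
by rewrite set0I measure0 mul0e.
Qed.

Lemma indep_future_comp (D : {pred I}) (Y : T -> S1) (f : S1 -> S2) :
  measurable_fun setT f -> indep_future X D Y -> indep_future X D (f \o Y).
Proof.
move=> mf iY B s A mB us sD mA; rewrite comp_preimage.
by apply: iY => //; rewrite -[X in measurable X]setTI; exact: mf.
Qed.

Lemma indep_future_sub (D D' : {pred I}) (Y : T -> S1) :
  {subset D' <= D} -> indep_future X D Y -> indep_future X D' Y.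
Proof. by move=> DD' iY B s A mB us sD mA; apply: iY => // i /sD /DD'. Qed.

Lemma indep_future_rect (D : {pred I}) (Y : T -> S1) k A B :
  indep_future X D Y -> k \in D -> measurable A -> measurable B ->
  P (Y @^-1` A `&` X k @^-1` B) = P (Y @^-1` A) * P (X k @^-1` B).
Proof.
move=> iY kD mA mB.
have := iY A [:: k] (fun=> B) mA isT; rewrite !big_seq1; apply => //.
by move=> i; rewrite inE => /eqP ->.
Qed.

(** Fix the event E described by the remaining variables. Both P((Y, X_k) in C, E) and P(E) P((Y,
    X_k) in C) are finite measures in C, and they agree on rectangles by the independence of Y from
    X_k together with the remaining variables. *)
Lemma indep_future_pair (D D' : {pred I}) (Y : T -> S1) k :
  measurable_fun setT Y -> indep_future X D Y ->
  k \in D -> k \notin D' -> {subset D' <= D} ->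
  indep_future X D' (fun w => (Y w, X k w)).
Proof.
move=> mY iY kD kD' DD' C s A mC us sD' mA.
pose E := \big[setI/setT]_(i <- s) (X i @^-1` A i).
have mE : measurable E.
  by apply: bigsetI_measurable => i _; exact: mpre.
have PE : P E = \prod_(i <- s) P (X i @^-1` A i).
  have := iY setT s A measurableT us (fun i h => DD' _ (sD' _ h)) mA.
  by rewrite preimage_setT setTI probability_setT mul1e.
rewrite -PE -/E.
pose Z := fun w => (Y w, X k w).
have mZ : measurable_fun setT Z by exact: measurable_fun_pair.
pose c : {nonneg R} := NngNum (fine_ge0 (measure_ge0 P E)).
pose m1 : {measure set (S1 * R) -> \bar R} := pushforward (mrestr P mE) Z.
pose m2 : {measure set (S1 * R) -> \bar R} := mscale c (pushforward P Z).
have cE : c%:num%:E = P E by rewrite /= fineK// fin_num_measure.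
suff : m1 mZ C = m2 mZ C.
  by rewrite /m1 /m2 /= /mscale /= cE muleC.
apply: measure_rectangle_unique => //=; last first.
  rewrite /pushforward preimage_setT /mrestr setTI.
  by rewrite ltey_eq fin_num_measure.
move=> U V mU mV; rewrite /mscale /= cE /pushforward /mrestr.
have -> : Z @^-1` (U `*` V) = Y @^-1` U `&` X k @^-1` V by [].
rewrite (indep_future_rect iY)// -setIA.
(* [k] is outside [D'], hence not in [s], so one family can prescribe [V] at [k] and [A] on [s]. *)
pose A' i := if i == k then V else A i.
have A'E i : i \in s -> A' i = A i.
  by move=> si; rewrite /A'; case: eqP => // ik; move: kD'; rewrite -ik sD'.
have := iY U (k :: s) A' mU.
have A'k : A' k = V by rewrite /A' eqxx.
rewrite /= us andbT !big_cons A'k.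
rewrite (eq_big_seq (fun i => X i @^-1` A i)); last first.
  by move=> i si /=; rewrite A'E.
rewrite (eq_big_seq (fun i => P (X i @^-1` A i))); last first.
  by move=> i si /=; rewrite A'E.
rewrite -PE -/E muleA => ->.
- by rewrite muleC.
- by apply: contra kD' => /sD'.
- by move=> i; rewrite inE => /predU1P[->//|/sD' /DD'].
- by move=> i; rewrite /A'; case: ifP.
Qed.

End IndepFuture.

End Independence.

(** * The transition kernel *)

Section Kernel.
Context {R : realType}.
Local Open Scope ereal_scope.
Context d0 (T0 : measurableType d0) (P0 : probability T0 R).

Lemma measurable_integral2 d1 (S : measurableType d1)
    (F : S * T0 -> \bar R) :
  measurable_fun setT F -> (forall z, 0 <= F z) ->
  measurable_fun setT (fun y => \int[P0]_v F (y, v)).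
Proof. by move=> mF F0; exact: measurable_fun_fubini_tonelli_F. Qed.

Lemma measurable_integral_rv d1 (S : measurableType d1) (h : {RV P0 >-> R})
    (F : S * R -> \bar R) :
  measurable_fun setT F -> (forall z, 0 <= F z) ->
  measurable_fun setT (fun y => \int[P0]_v F (y, h v)).
Proof.
move=> mF F0; apply: (measurable_integral2 (F := fun z => F (z.1, h z.2))) => //.
apply: measurableT_comp => //; apply: measurable_fun_pair => //.
exact: measurableT_comp.
Qed.

Lemma integral_cst_probability d (T : measurableType d) (P : probability T R)
  (k : \bar R) : \int[P]_w k = k.
Proof.
rewrite [LHS](integral_cst P measurableT k) [X in _ * X](_ : _ = 1) ?mule1//.
exact: probability_setT.
Qed.

Section Quadruple.
Variable g : nat -> {RV P0 >-> R}.

Section Iterated.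
Context d (T : measurableType d) (P : probability T R).
Context (I : eqType) (X : I -> {RV P >-> R}).

Lemma ge0_integral_indep_future (D : {pred I}) d1 (S : measurableType d1)
    (Y : T -> S) k i (F : S * R -> \bar R) :
  measurable_fun setT Y -> indep_future X D Y -> k \in D ->
  (forall A, measurable A -> P (X k @^-1` A) = P0 (g i @^-1` A)) ->
  measurable_fun setT F -> (forall z, 0 <= F z) ->
  \int[P]_w F (Y w, X k w) = \int[P]_w \int[P0]_v F (Y w, g i v).
Proof.
move=> mY iY kD XgE mF F0; apply: ge0_integral_indep => // A B mA mB.
by rewrite -XgE//; exact: indep_future_rect iY _ _ _.
Qed.

(** The last variable is integrated out first, the others being already packed with Y; each use of
    independence replaces one variable by its counterpart on [P0]. *)
Lemma ge0_integral_quadruple (D : {pred I}) d1 (S : measurableType d1)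
    (Y : T -> S) k1 k2 k3 k4 (F : S * R * R * R * R -> \bar R) :
  measurable_fun setT Y -> indep_future X D Y ->
  uniq [:: k1; k2; k3; k4] -> {subset [:: k1; k2; k3; k4] <= D} ->
  (forall A, measurable A -> P (X k1 @^-1` A) = P0 (g 1%N @^-1` A)) ->
  (forall A, measurable A -> P (X k2 @^-1` A) = P0 (g 2%N @^-1` A)) ->
  (forall A, measurable A -> P (X k3 @^-1` A) = P0 (g 3%N @^-1` A)) ->
  (forall A, measurable A -> P (X k4 @^-1` A) = P0 (g 4%N @^-1` A)) ->
  measurable_fun setT F -> (forall z, 0 <= F z) ->
  \int[P]_w F (Y w, X k1 w, X k2 w, X k3 w, X k4 w) =
  \int[P]_w \int[P0]_v1 \int[P0]_v2 \int[P0]_v3 \int[P0]_v4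
    F (Y w, g 1%N v1, g 2%N v2, g 3%N v3, g 4%N v4).
Proof.
move=> mY iY /=; rewrite !inE !negb_or andbT => /and3P[/and3P[k12 k13 k14]].
move=> /andP[k23 k24] k34 kD XE1 XE2 XE3 XE4 mF F0.
pose D1 := [pred i | (i \in D) && (i != k1)].
pose D2 := [pred i | (i \in D1) && (i != k2)].
pose D3 := [pred i | (i \in D2) && (i != k3)].
have k1D : k1 \in D by apply: kD; rewrite !inE eqxx.
have k2D : k2 \in D1 by rewrite inE kD ?inE ?eqxx ?orbT//= eq_sym.
have k3D : k3 \in D2.
  by rewrite !inE kD ?inE ?eqxx ?orbT//= ![k3 == _]eq_sym k13 k23.
have k4D : k4 \in D3.
  by rewrite !inE kD ?inE ?eqxx ?orbT//= ![k4 == _]eq_sym k14 k24 k34.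
pose Y1 w := (Y w, X k1 w); pose Y2 w := (Y1 w, X k2 w).
pose Y3 w := (Y2 w, X k3 w).
have mY1 : measurable_fun setT Y1 by exact: measurable_fun_pair.
have mY2 : measurable_fun setT Y2 by exact: measurable_fun_pair.
have mY3 : measurable_fun setT Y3 by exact: measurable_fun_pair.
have iY1 : indep_future X D1 Y1.
  apply: (indep_future_pair mY iY) => //; first by rewrite inE eqxx andbF.
  by move=> i /andP[].
have iY2 : indep_future X D2 Y2.
  apply: (indep_future_pair mY1 iY1) => //; first by rewrite inE eqxx andbF.
  by move=> i /andP[].
have iY3 : indep_future X D3 Y3.
  apply: (indep_future_pair mY2 iY2) => //; first by rewrite inE eqxx andbF.
  by move=> i /andP[].
pose F3 z := \int[P0]_v F (z, g 4%N v).
pose F2 z := \int[P0]_v F3 (z, g 3%N v).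
pose F1 z := \int[P0]_v F2 (z, g 2%N v).
have F30 z : 0 <= F3 z by exact: integral_ge0.
have F20 z : 0 <= F2 z by exact: integral_ge0.
have F10 z : 0 <= F1 z by exact: integral_ge0.
have mF3 : measurable_fun setT F3 by exact: measurable_integral_rv.
have mF2 : measurable_fun setT F2 by exact: measurable_integral_rv.
have mF1 : measurable_fun setT F1 by exact: measurable_integral_rv.
rewrite (ge0_integral_indep_future mY3 iY3 k4D XE4 mF F0).
rewrite (ge0_integral_indep_future mY2 iY2 k3D XE3 mF3 F30).
rewrite (ge0_integral_indep_future mY1 iY1 k2D XE2 mF2 F20).
exact: (ge0_integral_indep_future mY iY k1D XE1 mF1 F10).
Qed.


End Iterated.

(** The previous iterated form, with P = P0 and a constant Y, folds back into a single integral over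
    the quadruple itself. *)
Lemma ge0_integral_quadruple_self d1 (S : measurableType d1) (y : S)
    (F : S * R * R * R * R -> \bar R) :
  mutually_independent [pred i : nat | (1 <= i <= 4)%N] g ->
  measurable_fun setT F -> (forall z, 0 <= F z) ->
  \int[P0]_v F (y, g 1%N v, g 2%N v, g 3%N v, g 4%N v) =
  \int[P0]_v1 \int[P0]_v2 \int[P0]_v3 \int[P0]_v4
    F (y, g 1%N v1, g 2%N v2, g 3%N v3, g 4%N v4).
Proof.
move=> ig mF F0.
have kD : {subset [:: 1%N; 2%N; 3%N; 4%N] <= [pred i : nat | (1 <= i <= 4)%N]}.
  by move=> i; rewrite !inE => /or4P[] /eqP ->.
have same i A : measurable A -> P0 (g i @^-1` A) = P0 (g i @^-1` A) by [].
have -> := @ge0_integral_quadruple _ _ P0 _ g _ _ S (fun=> y) 1%N 2%N 3%N 4%N F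
  (measurable_cst y) (indep_future_cst y ig) isT kD (same 1%N) (same 2%N)
  (same 3%N) (same 4%N) mF F0.
exact: integral_cst_probability.
Qed.

Section Fresh.
Context d (T : measurableType d) (P : probability T R).
Context (I : eqType) (X : I -> {RV P >-> R}).

Lemma ge0_integral_fresh (D : {pred I}) d1 (S : measurableType d1)
    (Y : T -> S) k1 k2 k3 k4 (F : S * R * R * R * R -> \bar R) :
  mutually_independent [pred i : nat | (1 <= i <= 4)%N] g ->
  measurable_fun setT Y -> indep_future X D Y ->
  uniq [:: k1; k2; k3; k4] -> {subset [:: k1; k2; k3; k4] <= D} ->
  (forall A, measurable A -> P (X k1 @^-1` A) = P0 (g 1%N @^-1` A)) ->
  (forall A, measurable A -> P (X k2 @^-1` A) = P0 (g 2%N @^-1` A)) ->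
  (forall A, measurable A -> P (X k3 @^-1` A) = P0 (g 3%N @^-1` A)) ->
  (forall A, measurable A -> P (X k4 @^-1` A) = P0 (g 4%N @^-1` A)) ->
  measurable_fun setT F -> (forall z, 0 <= F z) ->
  \int[P]_w F (Y w, X k1 w, X k2 w, X k3 w, X k4 w) =
  \int[P]_w \int[P0]_v F (Y w, g 1%N v, g 2%N v, g 3%N v, g 4%N v).
Proof.
move=> ig mY iY uk kD XE1 XE2 XE3 XE4 mF F0.
rewrite (ge0_integral_quadruple mY iY uk kD XE1 XE2 XE3 XE4 mF F0).
by apply: eq_integral => w _; rewrite ge0_integral_quadruple_self.
Qed.

End Fresh.

Variables (x b : R).

(** The kernel acts on functions and depends only on [g], so that both chains share it. *)
Definition kern (f : R * R -> \bar R) (u : R * R) : \bar R :=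
  \int[P0]_v f (step_map x b (fun i => g i v) u).

(** The step map on a single tuple, the form in which joint measurability and [indep_future_comp]
    apply. *)
Definition stepz (z : R * R * R * R * R * R) : R * R :=
  let: (u, z1, z2, z3, z4) := z in
  (z2 / (z1 / (x + u.1) + z3 / (u.1 + u.2)), z4 / (b + z3 / (u.1 + u.2)))%R.

Lemma measurable_stepz : measurable_fun setT stepz.
Proof.
pose u (z : R * R * R * R * R * R) := z.1.1.1.1.
have mu : measurable_fun setT u by do 3 apply: measurableT_comp => //.
have mu1 : measurable_fun setT (fun z => (u z).1) by exact: measurableT_comp.
have mu2 : measurable_fun setT (fun z => (u z).2) by exact: measurableT_comp.
have -> : stepz = fun z => (z.1.1.2 / (z.1.1.1.2 / (x + (u z).1) +
    z.1.2 / ((u z).1 + (u z).2)), z.2 / (b + z.1.2 / ((u z).1 + (u z).2)))%R.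
  by apply/funext => -[[[[u1 z1] z2] z3] z4].
have mS : measurable_fun setT (fun z => ((u z).1 + (u z).2)^-1)%R.
  by apply: measurable_funV; exact: measurable_funD.
have p1 : measurable_fun setT (fun z : R * R * R * R * R * R => z.1).
  exact: measurable_fst.
have p2 := measurableT_comp measurable_fst p1.
have p3 := measurableT_comp measurable_fst p2.
have m1 := measurableT_comp measurable_snd p3.
have m2 := measurableT_comp measurable_snd p2.
have m3 := measurableT_comp measurable_snd p1.
apply: measurable_fun_pair; apply: measurable_funM => //;
  apply: measurable_funV; apply: measurable_funD => //; apply: measurable_funM => //.
by apply: measurable_funV; apply: measurable_funD.
Qed.

Lemma measurable_step_map d1 (S : measurableType d1) (U : S -> R * R)
    (h : nat -> S -> R) :
  measurable_fun setT U -> (forall i, measurable_fun setT (h i)) ->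
  measurable_fun setT (fun w => step_map x b (fun i => h i w) (U w)).
Proof.
move=> mU mh.
apply: (measurableT_comp (f := stepz)
  (g := fun w => (U w, h 1%N w, h 2%N w, h 3%N w, h 4%N w))).
  exact: measurable_stepz.
by do 4 (apply: measurable_fun_pair => //).
Qed.

Lemma measurable_kern f : measurable_fun setT f -> (forall u, 0 <= f u) ->
  measurable_fun setT (kern f).
Proof.
move=> mf f0.
apply: (measurable_integral2
  (F := fun z => f (step_map x b (fun i => g i z.2) z.1))) => //.
apply: measurableT_comp => //.
apply: measurable_step_map => // i; exact: measurableT_comp.
Qed.

Lemma kern_ge0 f u : (forall u, 0 <= f u) -> 0 <= kern f u.
Proof. by move=> f0; exact: integral_ge0. Qed.

Lemma iter_kern_measurable n f : measurable_fun setT f -> (forall u, 0 <= f u) ->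
  measurable_fun setT (iter n kern f) /\ forall u, 0 <= iter n kern f u.
Proof.
move=> mf f0; elim: n => [//|n [mn n0]]; split.
  exact: measurable_kern.
by move=> u; exact: kern_ge0.
Qed.

Section Chain.
Context d (T : measurableType d) (P : probability T R).
Variables (a : nat -> R) (gU : nat -> nat -> {RV P >-> R}).
Hypotheses (gP : gamma_quadruple a g) (gUP : gamma_noise a gU).
Variables (u0 : R * R) (U : nat -> {RV P >-> (R * R)%type}).
Hypothesis UP : is_chain x b gU u0 U.

Let I := (nat * nat)%type.
Let X (k : I) := gU k.1 k.2.
Let D t : {pred I} := [pred k : I | (t < k.1)%N && (1 <= k.2 <= 4)%N].

Let gUE t i (A : set R) : (1 <= t)%N -> (1 <= i <= 4)%N -> measurable A ->
  P (gU t i @^-1` A) = P0 (g i @^-1` A).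
Proof.
move=> t1 i14 mA.
by have := gUP.1 t i t1 i14 A mA; rewrite -(gP.1 i i14 A mA).
Qed.

(** By induction: the state at t + 1 is a function of the state at t and of four variables of time t
    + 1, which leave the future one at a time. *)
Lemma indep_future_chain t : indep_future X (D t) (U t).
Proof.
elim: t => [|t ih].
  rewrite (_ : (U 0%N : T -> R * R) = fun=> u0); last first.
    by apply/funext => w; rewrite UP.1.
  exact: (indep_future_cst u0 gUP.2).
rewrite (_ : (U t.+1 : T -> R * R) = stepz \o (fun w =>
    (U t w, X (t.+1, 1)%N w, X (t.+1, 2)%N w, X (t.+1, 3)%N w, X (t.+1, 4)%N w)));
  last by apply/funext => w; rewrite UP.2.
apply: indep_future_comp; first exact: measurable_stepz.
have step d1 (S : measurableType d1) (E : {pred I}) (Y : T -> S) k :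
    measurable_fun setT Y -> indep_future X E Y -> k \in E ->
    measurable_fun setT (fun w => (Y w, X k w)) /\
    indep_future X [pred i | (i \in E) && (i != k)] (fun w => (Y w, X k w)).
  move=> mY iY kE; split; first exact: measurable_fun_pair.
  apply: (indep_future_pair mY iY) => //; first by rewrite inE eqxx andbF.
  by move=> i /andP[].
have [//||m1 i1] := step _ _ _ (U t) (t.+1, 1)%N _ ih.
  by rewrite inE/= ltnS leqnn.
have [|m2 i2] := step _ _ _ _ (t.+1, 2)%N m1 i1.
  by rewrite !inE/= ltnS leqnn/= ?xpair_eqE/= ?andbF.
have [|m3 i3] := step _ _ _ _ (t.+1, 3)%N m2 i2.
  by rewrite !inE/= ltnS leqnn/= ?xpair_eqE/= ?andbF.
have [|m4 i4] := step _ _ _ _ (t.+1, 4)%N m3 i3.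
  by rewrite !inE/= ltnS leqnn/= ?xpair_eqE/= ?andbF.
apply: indep_future_sub i4 => -[s i]; rewrite !inE/= => /andP[ts ->].
rewrite (ltnW ts)/=.
have st (j : nat) : ((s, i) != (t.+1, j)).
  by apply/eqP => -[st _]; rewrite st ltnn in ts.
by rewrite !st.
Qed.

Lemma integral_chain_step t f : measurable_fun setT f -> (forall u, 0 <= f u) ->
  \int[P]_w f (U t.+1 w) = \int[P]_w kern f (U t w).
Proof.
move=> mf f0.
under eq_integral do rewrite UP.2.
apply: (@ge0_integral_fresh _ _ P _ X (D t) _ _ (U t)
  (t.+1, 1)%N (t.+1, 2)%N (t.+1, 3)%N (t.+1, 4)%N (f \o stepz)) => //.
- exact: gP.2.
- exact: indep_future_chain.
- by rewrite /= !inE !xpair_eqE/= eqxx.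
- by move=> k; rewrite !inE => /or4P[]/eqP->/=; rewrite ltnS leqnn.
- by move=> A mA; exact: gUE.
- by move=> A mA; exact: gUE.
- by move=> A mA; exact: gUE.
- by move=> A mA; exact: gUE.
- by apply: measurableT_comp => //; exact: measurable_stepz.
- by move=> z; exact: f0.
Qed.

Lemma integral_chain t f : measurable_fun setT f -> (forall u, 0 <= f u) ->
  \int[P]_w f (U t w) = iter t kern f u0.
Proof.
elim: t f => [|t ih] f mf f0.
  under eq_integral do rewrite UP.1.
  by rewrite integral_cst_probability.
rewrite integral_chain_step// ih ?iterSr//; first exact: measurable_kern.
by move=> u; exact: kern_ge0.
Qed.

Lemma distribution_chain t (A : set (R * R)) : measurable A ->
  distribution P (U t) A = iter t kern (EFin \o \1_A) u0.
Proof.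
move=> mA; rewrite -integral_chain//; last first.
- by move=> u; rewrite lee_fin.
- exact/measurable_EFinP.
have mUA : measurable (U t @^-1` A).
  exact: measurable_funPTI.
by have := integral_indic P measurableT mUA; rewrite setIT => /esym.
Qed.

End Chain.
End Quadruple.
End Kernel.

(** * Moments of Gamma variables *)

Section RealIntegrals.
Context {R : realType} d (T : measurableType d) (P : probability T R).
Local Open Scope ereal_scope.
Implicit Types f h : T -> R.

Lemma le_integral_EFin f h :
  measurable_fun setT f -> measurable_fun setT h ->
  (forall w, 0 <= f w)%R -> (forall w, f w <= h w)%R ->
  \int[P]_w (f w)%:E <= \int[P]_w (h w)%:E.
Proof.
move=> mf mh f0 fh; apply: ge0_le_integral => //.
- by move=> w _; rewrite lee_fin.
- exact/measurable_EFinP.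
- by apply/measurable_EFinP.
- by move=> w _; rewrite lee_fin.
Qed.

Lemma integral_EFinD f h :
  measurable_fun setT f -> measurable_fun setT h ->
  (forall w, 0 <= f w)%R -> (forall w, 0 <= h w)%R ->
  \int[P]_w (f w + h w)%:E = \int[P]_w (f w)%:E + \int[P]_w (h w)%:E.
Proof.
move=> mf mh f0 h0; under eq_integral do rewrite EFinD.
rewrite ge0_integralD//.
- by move=> w _; rewrite lee_fin.
- exact/measurable_EFinP.
- by move=> w _; rewrite lee_fin.
- exact/measurable_EFinP.
Qed.

Lemma integral_EFinZ k f : measurable_fun setT f ->
  (forall w, 0 <= f w)%R -> (0 <= k)%R ->
  \int[P]_w (k * f w)%:E = k%:E * \int[P]_w (f w)%:E.
Proof.
move=> mf f0 k0; under eq_integral do rewrite EFinM.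
rewrite ge0_integralZl//.
- exact/measurable_EFinP.
- by move=> w _; rewrite lee_fin.
Qed.

Lemma integral_EFin_ge0 f : (forall w, 0 <= f w)%R -> 0 <= \int[P]_w (f w)%:E.
Proof. by move=> f0; apply: integral_ge0 => w _; rewrite lee_fin. Qed.

Lemma integral_EFin_bounded f (c : R) : (forall w, 0 <= f w)%R ->
  \int[P]_w (f w)%:E <= c%:E ->
  exists r, [/\ \int[P]_w (f w)%:E = r%:E, (0 <= r)%R & (r <= c)%R].
Proof.
move=> f0; have := integral_EFin_ge0 f0.
case: (\int[P]_w (f w)%:E) => [r| |]//.
by rewrite !lee_fin => r0 rc; exists r.
Qed.

(** Monotone convergence. It allows inverse moments to be handled as finite numbers before their
    integrability is known. *)
Lemma le_integral_inv (g y : T -> R) (C : \bar R) :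
  measurable_fun setT g -> measurable_fun setT y ->
  (forall w, 0 <= g w)%R -> (forall w, 0 < y w)%R ->
  (forall n, \int[P]_w (g w / (y w + n.+1%:R^-1))%:E <= C) ->
  \int[P]_w (g w / y w)%:E <= C.
Proof.
move=> mg my g0 y0 bnd.
pose F n w := (g w / (y w + n.+1%:R^-1))%:E.
have nd w m n : (m <= n)%N -> F m w <= F n w.
  move=> mn; rewrite lee_fin ler_wpM2l// lef_pV2 ?posrE ?ltr_wpDr ?invr_ge0//.
  by rewrite lerD2l lef_pV2 ?posrE// ler_nat ltnS.
have cF w : F n w @[n --> \oo] --> (g w / y w)%:E.
  apply/cvg_EFin; first exact: nearW.
  apply: cvgM; first exact: cvg_cst.
  apply: cvgV; first by rewrite gt_eqF.
  rewrite -[X in _ --> X]addr0.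
  by apply: cvgD; [exact: cvg_cst|exact: cvg_harmonic].
rewrite (eq_integral (fun w => limn (F ^~ w))); last first.
  by move=> w _; apply/esym/cvg_lim => //; exact: cF.
have mF n : measurable_fun setT (F n).
  apply/measurable_EFinP/measurable_funM => //; apply: measurable_funV.
  exact: measurable_funD.
have F0 n w : setT w -> 0 <= F n w.
  by move=> _; rewrite lee_fin divr_ge0// addr_ge0// ltW.
have ndF w : setT w -> nondecreasing_seq (F ^~ w).
  by move=> _ m n; exact: nd.
rewrite (monotone_convergence P measurableT mF F0 ndF).
apply: lime_le; last exact: nearW.
apply: ereal_nondecreasing_is_cvgn => m n mn.
by apply: ge0_le_integral => // w _; [exact: F0|exact: nd].
Qed.

End RealIntegrals.

(** * First-order bounds on (1 + l)^(-s) *)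

Section PowRBounds.
Context {R : realType}.
Implicit Types s l : R.

Lemma powRN_ge s l : 0 <= s -> 0 < l -> 1 - s * l <= (1 + l) `^ (- s).
Proof.
move=> s0 l0.
have l1 : 0 < 1 + l by rewrite addr_gt0.
rewrite /powR gt_eqF// (le_trans _ (expR_ge1Dx _))// lerD2l mulNr lerN2.
by rewrite ler_wpM2l// le_ln1Dx// (lt_trans _ l0)// ltrN10.
Qed.

Lemma ln1D_ge l : 0 < l -> l / (1 + l) <= ln (1 + l).
Proof.
move=> l0; have l1 : 0 < 1 + l by rewrite addr_gt0.
rewrite -[leRHS]opprK -lnV ?posrE// lerNr.
have e : (1 + l)^-1 = 1 + (- (l / (1 + l))) by field; rewrite gt_eqF.
rewrite {1}e.
by apply: le_ln1Dx; rewrite ltrN2 ltr_pdivrMr// mul1r ltrDr.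
Qed.

Lemma powRN_le s l : 0 <= s -> 0 < l ->
  (1 + l) `^ (- s) <= (1 + l) / (1 + l + s * l).
Proof.
move=> s0 l0; have l1 : 0 < 1 + l by rewrite addr_gt0.
have sl : 0 <= s * l by rewrite mulr_ge0// ltW.
rewrite powRN -[leRHS]invf_div lef_pV2 ?posrE ?powR_gt0//; last first.
  by rewrite divr_gt0// ltr_pwDl.
rewrite /powR gt_eqF// (le_trans _ (expR_ge1Dx _))//.
rewrite mulrDl mulfV ?gt_eqF// lerD2l -mulrA ler_wpM2l//.
exact: ln1D_ge.
Qed.

(** Stands for the limit l -> 0, so that no Laplace transform has to be differentiated. *)
Lemma ler_addlM (u v k : R) : (forall l, 0 < l -> u <= v + k * l) -> u <= v.
Proof.
move=> uv; apply/ler_addgt0Pr => e e0.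
have k1 : 0 < `|k| + 1 by rewrite ltr_wpDl.
rewrite (le_trans (uv (e / (`|k| + 1)) _)) ?divr_gt0// lerD2l.
rewrite mulrCA ler_piMr ?(ltW e0)// ler_pdivrMr// mul1r.
by rewrite (le_trans (ler_norm _))// lerDl.
Qed.

End PowRBounds.

Section Moments.
Context {R : realType} d (T : measurableType d) (P : probability T R).
Local Open Scope ereal_scope.
Variables (X : T -> R) (a : R).
Hypotheses (mX : measurable_fun setT X) (X0 : forall w, (0 < X w)%R).
Hypothesis (Xa : gamma_scaling P X a).

(** The scaling identity at c = 1/(1 + l), where the weight exp(X (1 - 1/c)) is exp(-l X). *)
Lemma gamma_laplace (h : R -> R) (l : R) : (0 < l)%R ->
  measurable_fun setT h -> (forall z, 0 <= h z)%R ->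
  \int[P]_w (h (X w) * expR (- l * X w))%:E =
  ((1 + l) `^ (- a))%:E * \int[P]_w (h ((1 + l)^-1 * X w))%:E.
Proof.
move=> l0 mh h0; have l1 : (0 < 1 + l)%R by rewrite addr_gt0.
have li : (0 < (1 + l)^-1)%R by rewrite invr_gt0.
rewrite (@Xa (1 + l)^-1%R (fun z => (h z)%:E) li); last 2 first.
- exact/measurable_EFinP.
- by move=> z; rewrite lee_fin.
rewrite muleA -EFinM -powR_inv1 ?ltW// -powRrM mulN1r opprK -powRD; last first.
  by rewrite (gt_eqF l1) implybT.
rewrite addNr powRr0 mul1e powR_inv1 ?ltW//.
apply: eq_integral => w _; rewrite -EFinM invrK.
by congr (_ * expR _)%:E; ring.
Qed.

Let mexp l : measurable_fun setT (fun w => expR (- l * X w)).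
Proof. by apply: measurableT_comp => //; apply: measurable_funM. Qed.

(** First order in l of E[X^k exp(-l X)] = (1 + l)^(-(a + k)) E[X^k]. As l X/(1 + l X) <= 1 - exp(-l
    X), this bounds E[X^(k+1)/(1 + l X)] by (a + k) m for each l. *)
Lemma gamma_moment_le k m : (0 <= a)%R ->
  \int[P]_w (X w ^+ k)%:E = m%:E ->
  \int[P]_w (X w ^+ k.+1)%:E <= ((a + k%:R) * m)%:E.
Proof.
move=> a0 Xm.
have mXk : measurable_fun setT (fun w => X w ^+ k)%R by exact: measurable_funX.
have Xk0 w : (0 <= X w ^+ k)%R by rewrite exprn_ge0// ltW.
have m0 : (0 <= m)%R by rewrite -lee_fin -Xm integral_EFin_ge0.
(* Written as a quotient by 1/X, the power X^(k+1) has X^(k+1)/(1 + l X) as its regularisation in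
   [le_integral_inv]. *)
suff : \int[P]_w (X w ^+ k / (X w)^-1)%:E <= ((a + k%:R) * m)%:E.
  by under eq_integral do rewrite invrK -exprSr.
apply: le_integral_inv => //; first exact: measurable_funV.
  by move=> w; rewrite invr_gt0.
move=> n; pose l : R := (n.+1%:R^-1)%R; rewrite -/l.
have l0 : (0 < l)%R by rewrite invr_gt0.
have l1 : (0 < 1 + l)%R by rewrite addr_gt0.
have ml : measurable_fun setT (fun w => X w ^+ k * expR (- l * X w))%R.
  exact: measurable_funM.
have Il : \int[P]_w (X w ^+ k * expR (- l * X w))%:E =
    ((1 + l) `^ (- (a + k%:R)) * m)%:E.
  have := @gamma_laplace (fun z => `|z| ^+ k)%R l l0.
  under eq_integral do rewrite gtr0_norm//.
  move=> ->; last 2 first.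
  - by apply: measurable_funX; apply: measurableT_comp (@normr_measurable R setT) _.
  - by move=> z; rewrite exprn_ge0.
  under eq_integral do rewrite gtr0_norm ?mulr_gt0 ?invr_gt0// exprMn.
  rewrite integral_EFinZ//; last by rewrite exprn_ge0// invr_ge0 ltW.
  rewrite Xm -!EFinM mulrA; congr (_ * _)%:E.
  rewrite opprD powRD; last by rewrite (gt_eqF l1) implybT.
  by congr (_ * _)%R; rewrite exprVn powR_invn// ltW.
pose f w := (l * (X w ^+ k / ((X w)^-1 + l)))%R.
have mV : measurable_fun setT (fun w => X w ^+ k / ((X w)^-1 + l))%R.
  apply: measurable_funM => //; apply: measurable_funV.
  by apply: measurable_funD => //; exact: measurable_funV.
have V0 w : (0 <= X w ^+ k / ((X w)^-1 + l))%R.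
  by rewrite divr_ge0// addr_ge0// ltW// invr_gt0.
have le1 : \int[P]_w (f w + X w ^+ k * expR (- l * X w))%:E <= m%:E.
  rewrite -Xm; apply: le_integral_EFin => //.
  - by apply: measurable_funD => //; apply: measurable_funM.
  - move=> w; apply: addr_ge0; last by rewrite mulr_ge0// expR_ge0.
    by rewrite /f mulr_ge0// ltW.
  move=> w; rewrite /f mulrCA -mulrDr ler_piMr//.
  have lX : (0 < l * X w)%R by rewrite mulr_gt0.
  have -> : (l / ((X w)^-1 + l) = 1 - (1 + l * X w)^-1)%R.
    by field; rewrite !gt_eqF// ?addr_gt0.
  rewrite mulNr expRN.
  have : ((expR (l * X w))^-1 <= (1 + l * X w)^-1)%R.
    by rewrite lef_pV2 ?posrE ?expR_gt0 ?addr_gt0// expR_ge1Dx.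
  by lra.
move: le1; rewrite integral_EFinD//; last 3 first.
- exact: measurable_funM.
- by move=> w; rewrite /f mulr_ge0// ltW.
- by move=> w; rewrite mulr_ge0// expR_ge0.
rewrite Il /f integral_EFinZ ?(ltW l0)//.
have := integral_EFin_ge0 P V0.
case: (\int[P]_w (X w ^+ k / ((X w)^-1 + l))%:E) => [r| |]//; last first.
  by rewrite mulry gtr0_sg// mul1e addye// leye_eq.
rewrite lee_fin => r0; rewrite -EFinM -EFinD !lee_fin => rm.
have ak : (0 <= a + k%:R)%R by rewrite addr_ge0.
have /(ler_wpM2r m0) := powRN_ge ak l0.
rewrite mulrBl mul1r => lm.
have : (l * r <= l * ((a + k%:R) * m))%R by lra.
by rewrite ler_pM2l.
Qed.

(** From 1 <= exp(-l X) + l X: the mean is at least (1 - (1 + l)^(-a))/l, which tends to a. *)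
Lemma gamma_mean_ge m : (0 <= a)%R -> \int[P]_w (X w)%:E = m%:E -> (a <= m)%R.
Proof.
move=> a0 Xm; apply: (@ler_addlM _ _ _ (m * (1 + a))%R) => l l0.
have l1 : (0 < 1 + l)%R by rewrite addr_gt0.
have m0 : (0 <= m)%R by rewrite -lee_fin -Xm integral_EFin_ge0// => w; exact: ltW.
have I1 : \int[P]_w (expR (- l * X w))%:E = ((1 + l) `^ (- a))%:E.
  have := @gamma_laplace (cst 1%R) l l0 (measurable_cst _).
  rewrite /=; under eq_integral do rewrite mul1r.
  by move=> -> //; rewrite integral_cst_probability mule1.
have : \int[P]_w 1 <= \int[P]_w (expR (- l * X w) + l * X w)%:E.
  apply: le_integral_EFin => //.
  - by apply: measurable_funD => //; exact: measurable_funM.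
  - by move=> w; have := expR_ge1Dx (- l * X w)%R; lra.
rewrite integral_cst_probability integral_EFinD//; last 2 first.
- exact: measurable_funM.
- by move=> w; rewrite mulr_ge0 ?ltW.
rewrite integral_EFinZ ?(ltW l0)//; last by move=> w; exact: ltW.
rewrite I1 Xm -EFinM -EFinD lee_fin => h.
have := powRN_le a0 l0.
have al : (0 <= a * l)%R by rewrite mulr_ge0// ltW.
have D0 : (0 < 1 + l + a * l)%R by lra.
rewrite ler_pdivlMr// => h2.
have : (1 <= (1 + l) `^ (- a) + l * m)%R by [].
rewrite -(ler_pM2r D0) => h3.
have h4 : (l * a <= l * (m + m * (1 + a) * l))%R.
  apply: le_trans (_ : l * m * (1 + l + a * l) <= _)%R; lra.
by rewrite ler_pM2l in h4.
Qed.

(** Let H be the mean of 1/(X + e). Bounding exp(-l X) below by 1 - l X gives H <=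
    E[exp(-l X)/(X + e)] + l, and the Laplace identity bounds this last mean by (1 + l)^(1-a) H. At
    first order in l, (a - 1) H <= 1, uniformly in e. *)
Lemma gamma_inv_le : (1 < a)%R -> \int[P]_w ((X w)^-1)%:E <= ((a - 1)^-1)%:E.
Proof.
move=> a1.
under eq_integral do rewrite -div1r.
apply: le_integral_inv => // n; pose e : R := (n.+1%:R^-1)%R; rewrite -/e.
have e0 : (0 < e)%R by rewrite invr_gt0.
have mH : measurable_fun setT (fun w => (X w + e)^-1)%R.
  by apply: measurable_funV; exact: measurable_funD.
have H0 w : (0 <= (X w + e)^-1)%R by rewrite invr_ge0 addr_ge0// ltW.
under eq_integral do rewrite div1r.
have [H [HE Hge0 _]] : exists r, [/\ \int[P]_w ((X w + e)^-1)%:E = r%:E,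
    (0 <= r)%R & (r <= e^-1)%R].
  apply: integral_EFin_bounded => //.
  rewrite -(integral_cst_probability P (e^-1)%:E).
  apply: le_integral_EFin => // w.
  by rewrite lef_pV2 ?posrE ?addr_gt0// lerDr ltW.
rewrite HE lee_fin -[leRHS]mul1r ler_pdivlMr ?subr_gt0//.
apply: (@ler_addlM _ _ _ a) => l l0.
have l1 : (0 < 1 + l)%R by rewrite addr_gt0.
pose f w := ((X w + e)^-1 * expR (- l * X w))%R.
have f0 w : (0 <= f w)%R by rewrite mulr_ge0// expR_ge0.
have mf : measurable_fun setT f by exact: measurable_funM.
have If : \int[P]_w (f w)%:E <= ((1 + l) `^ (- a) * ((1 + l) * H))%:E.
  have := @gamma_laplace (fun z => (`|z| + e)^-1)%R l l0.
  under eq_integral do rewrite gtr0_norm//.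
  rewrite /f => ->; last 2 first.
  - by apply: measurable_funV; apply: measurable_funD => //; exact: measurableT_comp.
  - by move=> z; rewrite invr_ge0 addr_ge0// ltW.
  rewrite EFinM lee_wpmul2l ?lee_fin ?powR_ge0// EFinM -HE -integral_EFinZ ?(ltW l1)//.
  under eq_integral do rewrite gtr0_norm ?mulr_gt0 ?invr_gt0//.
  apply: le_integral_EFin.
  - apply: measurable_funV; apply: measurable_funD => //; exact: measurable_funM.
  - exact: measurable_funM.
  - by move=> w; rewrite invr_ge0 addr_ge0 ?(ltW e0)// ltW// mulr_gt0// invr_gt0.
  move=> w.
  have Xw := X0 w; have Xe : (0 < X w + e)%R by rewrite addr_gt0.
  rewrite -[leRHS]invrK lef_pV2 ?posrE//; last 2 first.
  - by rewrite addr_gt0// mulr_gt0// invr_gt0.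
  - by rewrite invr_gt0 mulr_gt0// invr_gt0.
  rewrite invfM invrK mulrDr lerD2l ler_piMl// ?ltW//.
  by rewrite invf_lt1// ltrDl.
have [r [rE r0 rle]] := integral_EFin_bounded f0 If.
have : \int[P]_w ((X w + e)^-1)%:E <= \int[P]_w (f w + l)%:E.
  apply: le_integral_EFin => //; first exact: measurable_funD.
  move=> w; rewrite /f; have Xw := X0 w.
  have Xe : (0 < X w + e)%R by rewrite addr_gt0.
  rewrite -lerBlDl -[X in (X - _ <= _)%R]mulr1 -mulrBr mulrC ler_pdivrMr//.
  have := expR_ge1Dx (- l * X w)%R.
  have : (0 <= l * e)%R by rewrite mulr_ge0 ?ltW.
  by rewrite mulrDr; lra.
rewrite integral_EFinD//; last by move=> w; exact: ltW.
rewrite HE rE integral_cst_probability -EFinD lee_fin => Hr.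
have a0 : (0 <= a - 1)%R by rewrite subr_ge0 ltW.
have := powRN_le a0 l0.
have al : (0 <= (a - 1) * l)%R by rewrite mulr_ge0// ltW.
have D0 : (0 < 1 + l + (a - 1) * l)%R by lra.
rewrite ler_pdivlMr//.
have -> : ((1 + l) `^ (- (a - 1)) = (1 + l) `^ (- a) * (1 + l))%R.
  have -> : (- (a - 1) = - a + 1)%R by ring.
  rewrite powRD; last by rewrite (gt_eqF l1) implybT.
  by rewrite powRr1// ltW.
set q := ((1 + l) `^ (- a) * (1 + l))%R => hq.
have rq : (r <= q * H)%R by rewrite /q -mulrA.
have h3 : (H * (1 + l + (a - 1) * l) <= (q * H + l) * (1 + l + (a - 1) * l))%R.
  by rewrite ler_wpM2r ?(ltW D0)//; lra.
have h4 : (q * (1 + l + (a - 1) * l) * H <= (1 + l) * H)%R by rewrite ler_wpM2r.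
have h5 : (l * (H * (a - 1)) <= l * (1 + a * l))%R by lra.
by rewrite ler_pM2l in h5.
Qed.

End Moments.

(** * Dilating one variable jointly with independent ones *)

Section Joint.
Context {R : realType} d (T : measurableType d) (P : probability T R).
Local Open Scope ereal_scope.
Context (I : eqType) (g : I -> {RV P >-> R}) (D : {pred I}).
Context d1 (S : measurableType d1) (Y : T -> S) (i : I) (alpha : R).
Hypotheses (mY : measurable_fun setT Y) (iY : indep_future g D Y) (iD : i \in D).

Lemma integral_indep_self (F : S * R -> \bar R) :
  measurable_fun setT F -> (forall z, 0 <= F z) ->
  \int[P]_w F (Y w, g i w) = \int[P]_w \int[P]_v F (Y w, g i v).
Proof.
move=> mF F0; apply: ge0_integral_indep => // A B mA mB.
exact: indep_future_rect iY _ _ _.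
Qed.

Lemma integral_indep_prod (h : S -> R) (f : R -> R) :
  measurable_fun setT h -> measurable_fun setT f ->
  (forall z, 0 <= h z)%R -> (forall z, 0 <= f z)%R ->
  \int[P]_w (h (Y w) * f (g i w))%:E =
  (\int[P]_w (h (Y w))%:E) * \int[P]_w (f (g i w))%:E.
Proof.
move=> mh mf h0 f0.
have mF : measurable_fun setT (fun z : S * R => (h z.1 * f z.2)%:E).
  apply/measurable_EFinP/measurable_funM; exact: measurableT_comp.
have F0 (z : S * R) : 0 <= (h z.1 * f z.2)%:E by rewrite lee_fin mulr_ge0.
rewrite (integral_indep_self mF F0)/=.
under eq_integral => w _.
  rewrite integral_EFinZ//; last exact: measurableT_comp.
  over.
rewrite ge0_integralZr//.
- by apply/measurable_EFinP; exact: measurableT_comp.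
- by move=> w _; rewrite lee_fin.
- exact: integral_EFin_ge0.
Qed.

Hypothesis gi : gamma_scaling P (g i) alpha.

Let mexp (c : R) : measurable_fun setT (fun z : R => (expR (z * (1 - c^-1)))%:E).
Proof.
by apply/measurable_EFinP; apply: measurableT_comp => //; exact: measurable_funM.
Qed.

Lemma integral_scale (c : R) (F : S * R -> \bar R) : (0 < c)%R ->
  measurable_fun setT F -> (forall z, 0 <= F z) ->
  \int[P]_w F (Y w, c * g i w)%R =
  (c `^ (- alpha))%:E *
    \int[P]_w (F (Y w, g i w) * (expR (g i w * (1 - c^-1)))%:E).
Proof.
move=> c0 mF F0.
have mF' : measurable_fun setT (fun z : S * R => F (z.1, c * z.2)%R).
  apply: measurableT_comp => //; apply: measurable_fun_pair => //.
  exact: measurable_funM.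
rewrite (integral_indep_self mF' (fun z => F0 _))/=.
have mG : measurable_fun setT
    (fun z : S * R => F z * (expR (z.2 * (1 - c^-1)))%:E).
  by apply: emeasurable_funM => //; exact: measurableT_comp (mexp c) _.
have G0 (z : S * R) : 0 <= F z * (expR (z.2 * (1 - c^-1)))%:E.
  by rewrite mule_ge0// lee_fin expR_ge0.
rewrite (integral_indep_self mG G0)/= -ge0_integralZl//; last 3 first.
- have mI : measurable_fun setT
      (fun y => \int[P]_v (F (y, g i v) * (expR (g i v * (1 - c^-1)))%:E)).
    exact: (measurable_integral_rv (g i) mG G0).
  exact: measurableT_comp mI mY.
- by move=> w _; apply: integral_ge0 => v _; exact: (G0 (_, _)).
- by rewrite lee_fin powR_ge0.
apply: eq_integral => w _.
by rewrite (gi (h := fun z => F (Y w, z)) c0)//; exact: measurableT_comp.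
Qed.

(** Given Y the dilation factor is a constant c in [1, r], so the scaling identity applies:
    c^(-alpha) >= r^(-alpha), and the exponential weight is at least 1 because c >= 1 and the
    variable is positive. *)
Lemma integral_scale_ge (c : S -> R) (r : R) (F : S * R -> \bar R) :
  measurable_fun setT c -> (forall w, 1 <= c (Y w) <= r)%R -> (0 <= alpha)%R ->
  (forall w, 0 < g i w)%R ->
  measurable_fun setT F -> (forall z, 0 <= F z) ->
  (r `^ (- alpha))%:E * \int[P]_w F (Y w, g i w) <=
  \int[P]_w F (Y w, c (Y w) * g i w)%R.
Proof.
move=> mc c1r a0 g0 mF F0.
have mF' : measurable_fun setT (fun z : S * R => F (z.1, c z.1 * z.2)%R).
  apply: measurableT_comp => //; apply: measurable_fun_pair => //.
  by apply: measurable_funM => //; exact: measurableT_comp.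
rewrite (integral_indep_self mF' (fun z => F0 _))/= (integral_indep_self mF F0).
have mI (G : S * R -> \bar R) : measurable_fun setT G -> (forall z, 0 <= G z) ->
    measurable_fun setT (fun w => \int[P]_v G (Y w, g i v)).
  move=> mG G0.
  have mI : measurable_fun setT (fun y => \int[P]_v G (y, g i v)).
    exact: (measurable_integral_rv (g i) mG G0).
  exact: measurableT_comp mI mY.
rewrite -ge0_integralZl//; last 3 first.
- exact: mI.
- by move=> w _; exact: integral_ge0.
- by rewrite lee_fin powR_ge0.
apply: ge0_le_integral => //.
- by move=> w _; rewrite mule_ge0 ?lee_fin ?powR_ge0//; exact: integral_ge0.
- by apply: emeasurable_funM => //; exact: mI.
- exact: (mI _ mF' (fun z => F0 _)).
move=> w _; have /andP[c1 cr] := c1r w.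
have c0 : (0 < c (Y w))%R by rewrite (lt_le_trans _ c1).
have mFw : measurable_fun setT (fun z => F (Y w, z)) by exact: measurableT_comp.
rewrite [leRHS](gi (h := fun z => F (Y w, z)) c0)//.
apply: lee_pmul.
- by rewrite lee_fin powR_ge0.
- exact: integral_ge0.
- rewrite lee_fin !powRN lef_pV2 ?posrE ?powR_gt0//; last exact: lt_le_trans cr.
  by rewrite ge0_ler_powR ?nnegrE// ltW// (lt_le_trans c0).
apply: ge0_le_integral => //.
- exact: (measurableT_comp mFw).
- apply: emeasurable_funM; first exact: (measurableT_comp mFw).
  exact: measurableT_comp (mexp _) _.
move=> v _; rewrite lee_pemulr// lee_fin -[X in (X <= _)%R]expR0 ler_expR.
by rewrite mulr_ge0 ?(ltW (g0 _))// subr_ge0 invf_le1.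
Qed.

End Joint.

Section Quadruple.
Context {R : realType} d (T : measurableType d) (P : probability T R).
Local Open Scope ereal_scope.
Variables (a : nat -> R) (g : nat -> {RV P >-> R}).
Hypothesis gP : gamma_quadruple a g.
Let Dq : {pred nat} := [pred i : nat | (1 <= i <= 4)%N].

Lemma quadruple_scaling i : (1 <= i <= 4)%N ->
  gamma_scaling P (g i) (a i + a i.+1).
Proof. by move=> i14; apply: gamma_distributed_scaling; exact: gP.1. Qed.

Lemma quadruple_indep1 i : i \in Dq ->
  indep_future g [pred k | (k \in Dq) && (k != i)] (g i).
Proof.
move=> iD; have i0 := indep_future_cst tt gP.2.
have := @indep_future_pair _ _ _ _ _ g _ _ Dq
  [pred k | (k \in Dq) && (k != i)] _ i (measurable_cst tt) i0 iD.
rewrite !inE eqxx andbF => /(_ isT) h.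
apply: (indep_future_comp (f := snd) _ (h _)) => //.
by move=> k /andP[].
Qed.

Lemma quadruple_indep2 i j : i \in Dq -> j \in Dq -> j != i ->
  indep_future g [pred k | [&& k \in Dq, k != i & k != j]]
    (fun w => (g i w, g j w)).
Proof.
move=> iD jD ji.
apply: (indep_future_pair _ (quadruple_indep1 iD)) => //.
- by rewrite inE jD.
- by rewrite inE eqxx !andbF.
- by move=> k; rewrite !inE => /and3P[-> ->].
Qed.

Lemma quadruple_indep3 i j k : i \in Dq -> j \in Dq -> k \in Dq ->
  j != i -> k != i -> k != j ->
  indep_future g [pred l | [&& l \in Dq, l != i, l != j & l != k]]
    (fun w => (g i w, g j w, g k w)).
Proof.
move=> iD jD kD ji ki kj.
apply: (indep_future_pair _ (quadruple_indep2 iD jD ji)) => //.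
- exact: measurable_fun_pair.
- by rewrite inE kD ki.
- by rewrite inE eqxx !andbF.
- by move=> l; rewrite !inE => /and4P[-> -> ->].
Qed.

(** Dilating the two variables in turn adds the exponents and multiplies the exponential weights
    into one depending on the sum; no convolution is computed. *)
Lemma quadruple_sum_scaling i j : i \in Dq -> j \in Dq -> j != i ->
  gamma_scaling P (fun w => g i w + g j w)%R
    ((a i + a i.+1) + (a j + a j.+1)).
Proof.
move=> iD jD ji c h c0 mh h0.
have ij : i != j by rewrite eq_sym.
under eq_integral do rewrite mulrDr.
have mF : measurable_fun setT (fun z : R * R => h (c * z.1 + z.2)%R).
  apply: measurableT_comp => //; apply: measurable_funD => //.
  exact: measurable_funM.
have jD' : j \in [pred k | (k \in Dq) && (k != i)] by rewrite inE jD.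
have /= -> := @integral_scale _ _ _ P _ g _ _ _ (g i) j _
  (@measurable_funP _ _ _ _ setT (g i)) (quadruple_indep1 iD) jD'
  (quadruple_scaling jD) c _ c0 mF (fun z => h0 _).
have mG : measurable_fun setT
    (fun z : R * R => h (z.2 + z.1)%R * (expR (z.1 * (1 - c^-1)))%:E).
  apply: emeasurable_funM.
    by apply: measurableT_comp => //; exact: measurable_funD.
  apply/measurable_EFinP; apply: measurableT_comp => //.
  exact: measurable_funM.
have iD' : i \in [pred k | (k \in Dq) && (k != j)] by rewrite inE iD.
have G0 (z : R * R) : 0 <= h (z.2 + z.1)%R * (expR (z.1 * (1 - c^-1)))%:E.
  by rewrite mule_ge0// lee_fin expR_ge0.
have /= e := @integral_scale _ _ _ P _ g _ _ _ (g j) i _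
  (@measurable_funP _ _ _ _ setT (g j)) (quadruple_indep1 jD) iD'
  (quadruple_scaling iD) c _ c0 mG G0.
rewrite [X in _ * X]e.
rewrite muleA -EFinM -powRD; last by rewrite (gt_eqF c0) implybT.
rewrite -opprD addrC; congr (_ * _).
apply: eq_integral => w _ /=; rewrite -muleA -EFinM -expRD -mulrDl.
by rewrite [(g j w + _)%R]addrC.
Qed.

End Quadruple.

Section MeanLe.
Context {R : realType} d (T : measurableType d) (P : probability T R).
Local Open Scope ereal_scope.
Implicit Types f h : T -> R.

(** Carrying measurability and sign with the bound makes the notion stable under sums, scaling and
    domination, without separate integrability conditions. *)
Definition mean_le f (c : R) := [/\ measurable_fun setT f,
  (forall w, 0 <= f w)%R & \int[P]_w (f w)%:E <= c%:E].

Lemma mean_leD f h c k :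
  mean_le f c -> mean_le h k -> mean_le (fun w => f w + h w)%R (c + k)%R.
Proof.
move=> [mf f0 fc] [mh h0 hk]; split; first exact: measurable_funD.
  by move=> w; rewrite addr_ge0.
by rewrite integral_EFinD// EFinD leeD.
Qed.

Lemma mean_leZ f c k : (0 <= k)%R -> mean_le f c ->
  mean_le (fun w => k * f w)%R (k * c)%R.
Proof.
move=> k0 [mf f0 fc]; split; first exact: measurable_funM.
  by move=> w; rewrite mulr_ge0.
by rewrite integral_EFinZ// EFinM lee_wpmul2l.
Qed.

Lemma mean_le_cst k : (0 <= k)%R -> mean_le (fun=> k) k.
Proof. by move=> k0; split => //; rewrite integral_cst_probability. Qed.

Lemma mean_le_le f h c k : measurable_fun setT f -> (forall w, 0 <= f w)%R ->
  (forall w, f w <= h w)%R -> mean_le h c -> (c <= k)%R -> mean_le f k.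
Proof.
move=> mf f0 fh [mh h0 hc] ck; split => //.
apply: le_trans (le_integral_EFin P mf mh f0 fh) _.
by apply: le_trans hc _; rewrite lee_fin.
Qed.

Lemma mean_le_ge0 f c : mean_le f c -> (0 <= c)%R.
Proof.
by move=> [_ f0 fc]; rewrite -lee_fin; apply: le_trans fc; exact: integral_EFin_ge0.
Qed.

Lemma mean_le_sub f h c m : measurable_fun setT f -> (forall w, 0 <= f w)%R ->
  measurable_fun setT h -> (forall w, 0 <= h w)%R ->
  \int[P]_w (h w)%:E = m%:E ->
  mean_le (fun w => f w + h w)%R c -> mean_le f (c - m)%R.
Proof.
move=> mf f0 mh h0 hm [_ _]; rewrite integral_EFinD// hm => fc; split => //.
by rewrite EFinB leeBrDr.
Qed.

Lemma mean_le_const k c : mean_le (fun=> k) c -> (k <= c)%R.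
Proof. by move=> [_ _]; rewrite integral_cst_probability lee_fin. Qed.

(** The bound [c] rules out [+oo], on which [fine] would return 0; needed because [theta2] and
    [theta3] are defined through [fine]. *)
Lemma mean_le_fine f c : mean_le f c -> mean_le f (fine (\int[P]_w (f w)%:E)).
Proof.
move=> [mf f0 fc]; split => //.
by have [r [-> _ _]] := integral_EFin_bounded f0 fc.
Qed.

End MeanLe.

Section QuadrupleMeans.
Context {R : realType} d (T : measurableType d) (P : probability T R).
Variables (a : nat -> R) (g : nat -> {RV P >-> R}).
Hypothesis a_gt0 : forall i : nat, (1 <= i <= 5)%N -> 0 < a i.
Hypothesis gP : gamma_quadruple a g.
Hypothesis g0 : forall i w, 0 < g i w.

Definition gshape (i : nat) : R := a i + a i.+1.

Lemma gshape_gt0 i : (1 <= i <= 4)%N -> 0 < gshape i.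
Proof.
move=> /andP[i1 i4]; rewrite addr_gt0// a_gt0//.
  by rewrite i1 (leq_trans i4).
Qed.

(** The exact value matters, not just an upper bound: this mean is subtracted in [mean_cfac]. *)
Lemma gshape_mean i : (1 <= i <= 4)%N -> (\int[P]_w (g i w)%:E = (gshape i)%:E)%E.
Proof.
move=> i14; have s0 := gshape_gt0 i14.
have gi := quadruple_scaling gP i14.
have le1 : (\int[P]_w (g i w ^+ 1)%:E <= ((gshape i + 0) * 1)%:E)%E.
  apply: (gamma_moment_le (k := 0) _ _ gi) => //; first exact: ltW.
  under eq_integral do rewrite expr0.
  exact: integral_cst_probability.
move: le1; under eq_integral do rewrite expr1.
rewrite addr0 mulr1 => le1.
have [m [mE m0 ms]] := integral_EFin_bounded (fun w => ltW (g0 i w)) le1.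
rewrite mE; congr EFin; apply/eqP; rewrite eq_le ms/=.
exact: (gamma_mean_ge _ _ gi (ltW s0) mE).
Qed.

Lemma mean_le_gshape i : (1 <= i <= 4)%N -> mean_le P (g i) (gshape i).
Proof.
move=> i14; split => //; last by rewrite gshape_mean.
by move=> w; exact: ltW.
Qed.

Lemma mean_le_sqr i : (1 <= i <= 4)%N ->
  mean_le P (fun w => g i w ^+ 2) ((gshape i + 1) * gshape i).
Proof.
move=> i14; have s0 := gshape_gt0 i14; split.
- exact: measurable_funX.
- by move=> w; exact: sqr_ge0.
apply: (gamma_moment_le (k := 1) _ _ (quadruple_scaling gP i14)) => //.
  exact: ltW.
by under eq_integral do rewrite expr1; rewrite gshape_mean.
Qed.

Lemma mean_le_inv i : (1 <= i <= 4)%N -> 1 < gshape i ->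
  mean_le P (fun w => (g i w)^-1) (gshape i - 1)^-1.
Proof.
move=> i14 s1; split.
- exact: measurable_funV.
- by move=> w; rewrite invr_ge0 ltW.
exact: (gamma_inv_le _ _ (quadruple_scaling gP i14)).
Qed.

Lemma mean_le_inv2 i j : (1 <= i <= 4)%N -> (1 <= j <= 4)%N -> j != i ->
  1 < gshape i + gshape j ->
  mean_le P (fun w => (g i w + g j w)^-1) (gshape i + gshape j - 1)^-1.
Proof.
move=> i14 j14 ji s1.
have mS : measurable_fun setT (fun w => g i w + g j w) by exact: measurable_funD.
have S0 w : 0 < g i w + g j w by rewrite addr_gt0.
split.
- exact: measurable_funV.
- by move=> w; rewrite invr_ge0 ltW.
exact: (gamma_inv_le mS S0 (quadruple_sum_scaling gP i14 j14 ji)).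
Qed.

Lemma mean_le_prod i k (h f : R -> R) c e : (1 <= i <= 4)%N -> (1 <= k <= 4)%N ->
  k != i -> measurable_fun setT h -> measurable_fun setT f ->
  (forall z, 0 <= h z) -> (forall z, 0 <= f z) ->
  mean_le P (fun w => h (g i w)) c -> mean_le P (fun w => f (g k w)) e ->
  mean_le P (fun w => h (g i w) * f (g k w)) (c * e).
Proof.
move=> i14 k14 ki mh mf h0 f0 [mhi _ hc] [mfk _ fe]; split.
- exact: measurable_funM.
- by move=> w; rewrite mulr_ge0.
rewrite (integral_indep_prod _ (quadruple_indep1 gP i14))//; last first.
  by rewrite !inE k14.
by rewrite EFinM lee_pmul// integral_EFin_ge0.
Qed.

Lemma mean_le_ratio i k : (1 <= i <= 4)%N -> (1 <= k <= 4)%N -> k != i ->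
  1 < gshape i ->
  mean_le P (fun w => g k w / g i w) (gshape k / (gshape i - 1)).
Proof.
move=> i14 k14 ki s1.
(* [mean_le_prod] asks for functions nonnegative on the whole line, hence the absolute values, which
   positivity of [g] removes. *)
have mn := @normr_measurable R setT.
have : mean_le P (fun w => `|g i w|^-1 * `|g k w|) ((gshape i - 1)^-1 * gshape k).
  apply: (mean_le_prod (h := fun z => `|z|^-1) (f := fun z => `|z|) i14 k14 ki) => //.
  - exact: measurable_funV.
  - under eq_fun do rewrite gtr0_norm//; exact: mean_le_inv.
  - under eq_fun do rewrite gtr0_norm//; exact: mean_le_gshape.
rewrite mulrC; congr (mean_le P _ _).
by apply/funext => w; rewrite !gtr0_norm// mulrC.
Qed.

Lemma mean_le_ratio2 i j k : (1 <= i <= 4)%N -> (1 <= j <= 4)%N ->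
  (1 <= k <= 4)%N -> j != i -> k != i -> k != j ->
  1 < gshape i + gshape j ->
  mean_le P (fun w => g k w / (g i w + g j w))
    (gshape k / (gshape i + gshape j - 1)).
Proof.
move=> i14 j14 k14 ji ki kj s1.
have [mS S0 Sle] := mean_le_inv2 i14 j14 ji s1.
have [mk k0 kle] := mean_le_gshape k14.
split; first exact: measurable_funM.
  by move=> w; rewrite mulr_ge0.
pose h (z : R * R) := `|z.1 + z.2|^-1.
have hE w : h (g i w, g j w) = (g i w + g j w)^-1.
  by rewrite /h gtr0_norm//= addr_gt0.
have mh : measurable_fun setT h.
  apply: measurable_funV; apply: (measurableT_comp (@normr_measurable R setT)).
  exact: measurable_funD.
have := @integral_indep_prod _ _ _ P _ g _ _ _ (fun w => (g i w, g j w)) k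
  _ (quadruple_indep2 gP i14 j14 ji) _ h (fun z => `|z|).
under eq_integral do rewrite hE gtr0_norm// mulrC.
move=> ->//.
- under eq_integral do rewrite hE.
  under [X in (_ * X)%E]eq_integral do rewrite gtr0_norm//.
  by rewrite mulrC EFinM lee_pmul// integral_EFin_ge0.
- exact: measurable_fun_pair.
- by rewrite !inE k14 ki.
- by move=> z; rewrite /h invr_ge0.
Qed.

End QuadrupleMeans.

(** * Pathwise contraction *)

Section Pathwise.
Context {R : realType}.
Variables (x b : R).
Hypotheses (x0 : 0 < x) (b0 : 0 < b).
Implicit Types (l u : R * R) (r : R) (g : nat -> R).

Definition pos2 u := 0 < u.1 /\ 0 < u.2.
Definition sum2 u : R := u.1 + u.2.
Definition between l r u :=
  (l.1 <= u.1 <= r * l.1) /\ (l.2 <= u.2 <= r * l.2).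

Lemma sum2_gt0 u : pos2 u -> 0 < sum2 u.
Proof. by case=> u1 u2; exact: addr_gt0. Qed.

Definition cond1 g u : R := g 1%N / (x + u.1) + g 3%N / sum2 u.
Definition cond2 g u : R := b + g 3%N / sum2 u.

Lemma step_mapE g u : step_map x b g u = (g 2%N / cond1 g u, g 4%N / cond2 g u).
Proof. by []. Qed.

Definition posg g := forall i, 0 < g i.

Lemma cond1_gt0 g u : posg g -> pos2 u -> 0 < cond1 g u.
Proof.
move=> g0 u0; have [u1 u2] := u0.
by rewrite addr_gt0// divr_gt0// ?sum2_gt0// addr_gt0.
Qed.

Lemma cond2_gt0 g u : posg g -> pos2 u -> 0 < cond2 g u.
Proof. by move=> g0 u0; rewrite addr_gt0// divr_gt0// sum2_gt0. Qed.

Lemma pos2_step g u : posg g -> pos2 u -> pos2 (step_map x b g u).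
Proof.
by move=> g0 u0; split; rewrite step_mapE/= divr_gt0// ?cond1_gt0// cond2_gt0.
Qed.

Lemma pos2_between l r u : pos2 l -> between l r u -> pos2 u.
Proof.
move=> [l1 l2] [/andP[h1 _] /andP[h2 _]].
by split; [exact: lt_le_trans h1|exact: lt_le_trans h2].
Qed.

(** Along dilations of l, at ratio 1, the two coordinates of F have logarithmic derivatives 1 - 1/p1
    and 1 - 1/p2, where p1 is the sum of the first three terms and p2 is 1 plus the last one. The
    value p1 + p2 - 1 dominates both, so one factor serves both coordinates. *)
Definition cfac_den g l : R :=
  1 + l.1 / x + (x + l.1) ^+ 2 / (x * sum2 l) * (g 3%N / g 1%N) +
  g 3%N / (b * sum2 l).

Definition cfac g l : R := 1 - (cfac_den g l)^-1.

Lemma cfac_den_ge1 g l : posg g -> pos2 l -> 1 <= cfac_den g l.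
Proof.
move=> g0 l0; have S0 := sum2_gt0 l0; have [l1 _] := l0.
rewrite /cfac_den -!addrA lerDl !addr_ge0//.
- by rewrite divr_ge0// ltW.
- by rewrite mulr_ge0// divr_ge0 ?sqr_ge0// ?mulr_ge0 ?ltW.
- by rewrite divr_ge0 ?mulr_ge0 ?ltW.
Qed.

Lemma cfac_ge0 g l : posg g -> pos2 l -> 0 <= cfac g l.
Proof.
move=> g0 l0; have h := cfac_den_ge1 g0 l0.
by rewrite subr_ge0 invf_le1// (lt_le_trans _ h).
Qed.

Lemma cfac_le1 g l : posg g -> pos2 l -> cfac g l <= 1.
Proof.
move=> g0 l0; have h := cfac_den_ge1 g0 l0.
by rewrite lerBlDr lerDl invr_ge0 (le_trans _ h).
Qed.

Lemma cond1_anti g l r u : posg g -> pos2 l -> between l r u ->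
  cond1 g u <= cond1 g l.
Proof.
move=> g0 l0 lu; have u0 := pos2_between l0 lu.
have Sl := sum2_gt0 l0; have Su := sum2_gt0 u0.
move: lu l0 u0 => [/andP[h1 _] /andP[h2 _]] [l1 l2] [u1 u2].
apply: lerD; rewrite ler_pM2l// lef_pV2 ?posrE ?addr_gt0// ?lerD2l//.
exact: lerD.
Qed.

Lemma cond2_anti g l r u : posg g -> pos2 l -> between l r u ->
  cond2 g u <= cond2 g l.
Proof.
move=> g0 l0 lu; have u0 := pos2_between l0 lu.
have Sl := sum2_gt0 l0; have Su := sum2_gt0 u0.
move: lu l0 u0 => [/andP[h1 _] /andP[h2 _]] [l1 l2] [u1 u2].
rewrite lerD2l ler_pM2l// lef_pV2 ?posrE//.
exact: lerD.
Qed.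

Lemma sum2_between l r u : between l r u -> sum2 u <= r * sum2 l.
Proof. by move=> [/andP[_ h1] /andP[_ h2]]; rewrite /sum2 mulrDr lerD. Qed.

Lemma cond1_lower g l r u : posg g -> pos2 l -> 1 <= r -> between l r u ->
  cond1 g l <= (1 + (r - 1) * cfac g l) * cond1 g u.
Proof.
move=> g0 l0 r1 lu; have u0 := pos2_between l0 lu.
have r0 : 0 < r by rewrite (lt_le_trans _ r1).
have Sl := sum2_gt0 l0; have Su := sum2_gt0 u0.
have SuR := sum2_between lu.
have [l1 l2] := l0.
have g1 := g0 1%N; have g3 := g0 3%N.
have D1 := cfac_den_ge1 g0 l0.
pose N := cond1 g l; pose Nr := g 1%N / (x + r * l.1) + g 3%N / (r * sum2 l).
have N0 : 0 < N by exact: cond1_gt0.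
have rl1 : 0 < r * l.1 by rewrite mulr_gt0.
have xl1 : 0 < x + l.1 by rewrite addr_gt0.
have xrl1 : 0 < x + r * l.1 by rewrite addr_gt0.
have NrE : Nr <= cond1 g u.
  move: lu u0 => [/andP[_ h1] _] [u1 u2].
  apply: lerD; rewrite ler_pM2l// lef_pV2 ?posrE ?mulr_gt0// ?lerD2l//.
  by rewrite addr_gt0.
have c0 := cfac_ge0 g0 l0.
have r10 : 0 <= r - 1 by rewrite subr_ge0.
apply: (@le_trans _ _ ((1 + (r - 1) * cfac g l) * Nr)); last first.
  by rewrite ler_wpM2l// addr_ge0// mulr_ge0.
(* [k] is the inverse of the first three terms of [cfac_den]. The gap r Nr - N is (r - 1) times the
   right side of [kN], so it suffices that k Nr stays below it. *)
pose k := g 1%N * x / ((x + l.1) ^+ 2 * N).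
have k0 : 0 <= k.
  by rewrite divr_ge0// mulr_ge0// ?sqr_ge0// ltW.
have kc : (cfac_den g l)^-1 <= k.
  have kE : k^-1 = 1 + l.1 / x + (x + l.1) ^+ 2 / (x * sum2 l) * (g 3%N / g 1%N).
    rewrite /k /N /cond1; field.
    by rewrite !gt_eqF//= addr_gt0// mulr_gt0.
  rewrite -[leRHS]invrK lef_pV2 ?posrE.
  - by rewrite kE lerDl divr_ge0// ltW// mulr_gt0.
  - by rewrite (lt_le_trans _ D1).
  - by rewrite invr_gt0 divr_gt0 ?mulr_gt0// exprn_gt0.
have kN : k * Nr <= g 1%N * x / ((x + l.1) * (x + r * l.1)).
  have e1 : Nr * (x + r * l.1) <= N * (x + l.1).
    have -> : Nr * (x + r * l.1) = g 1%N + g 3%N * (x / r + l.1) / sum2 l.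
      by rewrite /Nr; field; rewrite !gt_eqF.
    have -> : N * (x + l.1) = g 1%N + g 3%N * (x + l.1) / sum2 l.
      by rewrite /N /cond1; field; rewrite !gt_eqF.
    rewrite lerD2l ler_pM2r ?invr_gt0// ler_pM2l// lerD2r.
    by rewrite ler_pdivrMr// ler_peMr// ltW.
  rewrite ler_pdivlMr ?mulr_gt0//.
  have -> : k * Nr * ((x + l.1) * (x + r * l.1)) =
      g 1%N * x / ((x + l.1) * N) * (Nr * (x + r * l.1)).
    by rewrite /k; field; rewrite !gt_eqF.
  rewrite [leRHS](_ : _ = g 1%N * x / ((x + l.1) * N) * (N * (x + l.1))).
    by rewrite ler_wpM2l// divr_ge0// mulr_ge0// ltW.
  by field; rewrite !gt_eqF.
have Nr0 : 0 <= Nr.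
  by rewrite addr_ge0// divr_ge0// ltW// mulr_gt0.
have rNr : r * Nr = N + (r - 1) * (g 1%N * x / ((x + l.1) * (x + r * l.1))).
  by rewrite /Nr /N /cond1; field; rewrite !gt_eqF.
have h1 : (cfac_den g l)^-1 * Nr <= g 1%N * x / ((x + l.1) * (x + r * l.1)).
  by rewrite (le_trans _ kN)// ler_wpM2r.
have h2 := ler_wpM2l r10 h1.
have -> : (1 + (r - 1) * cfac g l) * Nr =
    r * Nr - (r - 1) * ((cfac_den g l)^-1 * Nr) by rewrite /cfac; ring.
by rewrite rNr -/N; lra.
Qed.

Lemma cond2_lower g l r u : posg g -> pos2 l -> 1 <= r -> between l r u ->
  cond2 g l <= (1 + (r - 1) * cfac g l) * cond2 g u.
Proof.
move=> g0 l0 r1 lu; have u0 := pos2_between l0 lu.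
have r0 : 0 < r by rewrite (lt_le_trans _ r1).
have Sl := sum2_gt0 l0; have Su := sum2_gt0 u0.
have SuR := sum2_between lu.
have [l1 l2] := l0.
have g1 := g0 1%N; have g3 := g0 3%N.
have D1 := cfac_den_ge1 g0 l0.
have bS : 0 < b * sum2 l by rewrite mulr_gt0.
pose q := g 3%N / (b * sum2 l).
have q0 : 0 < q by rewrite divr_gt0.
have N2 : b + g 3%N / (r * sum2 l) <= cond2 g u.
  by rewrite lerD2l ler_pM2l// lef_pV2 ?posrE ?mulr_gt0.
have -> : cond2 g l = b * (1 + q) by rewrite /cond2 /q; field; rewrite !gt_eqF.
have e : b + g 3%N / (r * sum2 l) = b * (1 + q / r).
  by rewrite /q; field; rewrite !gt_eqF.
have c0 := cfac_ge0 g0 l0.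
have r10 : 0 <= r - 1 by rewrite subr_ge0.
apply: (@le_trans _ _ ((1 + (r - 1) * cfac g l) * (b * (1 + q / r)))); last first.
  by rewrite -e ler_wpM2l// addr_ge0// mulr_ge0.
have q1 : 0 < 1 + q by rewrite addr_gt0.
have Dp : 0 < cfac_den g l by rewrite (lt_le_trans _ D1).
have kc : (cfac_den g l)^-1 <= (1 + q)^-1.
  rewrite lef_pV2 ?posrE//.
  rewrite /cfac_den -/q lerD2r -addrA lerDl addr_ge0//.
    by rewrite divr_ge0// ltW.
  by rewrite mulr_ge0// divr_ge0 ?sqr_ge0// ?mulr_ge0 ?ltW.
have cq : q / (1 + q) <= cfac g l.
  have -> : q / (1 + q) = 1 - (1 + q)^-1 by field; rewrite gt_eqF.
  by rewrite /cfac lerD2l lerN2.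
rewrite mulrCA ler_pM2l//.
apply: (@le_trans _ _ ((1 + (r - 1) * (q / (1 + q))) * (1 + q / r))); last first.
  rewrite ler_wpM2r ?lerD2l ?ler_wpM2l//.
  by rewrite addr_ge0// divr_ge0// ltW.
(* The excess over 1 + q is a square times a nonnegative factor. *)
have -> : (1 + (r - 1) * (q / (1 + q))) * (1 + q / r) =
    1 + q + (r - 1) ^+ 2 * q / (r * (1 + q)).
  by field; rewrite !gt_eqF.
rewrite lerDl; apply: divr_ge0; apply: mulr_ge0; rewrite ?sqr_ge0//;
  exact: ltW.
Qed.

Lemma between_step g l r u : posg g -> pos2 l -> 1 <= r -> between l r u ->
  between (step_map x b g l) (1 + (r - 1) * cfac g l) (step_map x b g u).
Proof.
move=> g0 l0 r1 lu; have u0 := pos2_between l0 lu.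
have c1l := cond1_gt0 g0 l0; have c1u := cond1_gt0 g0 u0.
have c2l := cond2_gt0 g0 l0; have c2u := cond2_gt0 g0 u0.
have c0 := cfac_ge0 g0 l0.
have g2 := g0 2%N; have g4 := g0 4%N.
split; rewrite !step_mapE/=.
  rewrite ler_pM2l// lef_pV2 ?posrE// (cond1_anti g0 l0 lu)/=.
  rewrite mulrCA ler_pM2l// ler_pdivlMr// mulrC ler_pdivrMr//.
  exact: cond1_lower.
rewrite ler_pM2l// lef_pV2 ?posrE// (cond2_anti g0 l0 lu)/=.
rewrite mulrCA ler_pM2l// ler_pdivlMr// mulrC ler_pdivrMr//.
exact: cond2_lower.
Qed.

End Pathwise.

(** * The decay exponent *)

Section Exponent.
Context {R : realType}.

(** Telescoping 2 = 8/4 and ln((n + 1)/n) >= 1/(n + 1): already 1/5 + 1/6 + 1/7 + 1/8 > 0.63. *)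
Lemma ln2_ge : 63 / 100 <= ln 2 :> R.
Proof.
have lnge (m n : R) : 0 < n -> m = n + 1 -> 1 / m <= ln (m / n).
  move=> n0 mE; have m0 : 0 < m by rewrite mE addr_gt0.
  rewrite -[leRHS]opprK -lnV ?posrE ?divr_gt0// lerNr.
  have -> : (m / n)^-1 = 1 + - (1 / m) by rewrite mE; field; rewrite -mE !gt_eqF.
  by apply: le_ln1Dx; rewrite ltrN2 ltr_pdivrMr// mul1r mE ltrDr.
have h5 := lnge 5 4 ltac:(lra) ltac:(lra).
have h6 := lnge 6 5 ltac:(lra) ltac:(lra).
have h7 := lnge 7 6 ltac:(lra) ltac:(lra).
have h8 := lnge 8 7 ltac:(lra) ltac:(lra).
have -> : 2 = 5 / 4 * (6 / 5) * (7 / 6) * (8 / 7) :> R by field.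
by rewrite 3?lnM ?posrE ?mulr_gt0 ?divr_gt0//; lra.
Qed.

Lemma lnN_le (b : R) : 0 < b -> - ln b <= b^-1 - 1.
Proof.
move=> b0; rewrite -lnV ?posrE//.
have -> : b^-1 = 1 + (b^-1 - 1) by ring.
rewrite [X in _ <= X]addrAC subrr add0r.
by apply: le_ln1Dx; rewrite ltrBrDr addNr invr_gt0.
Qed.

(* The gain of the pair (r, beta): a contraction by r over two steps absorbs
   the expected excursion length governed by beta, at speed lam per step. *)
Lemma exponent_bounds (beta r d : R) :
  1 / 2 <= beta < 1 -> 15 / 16 <= r < 1 ->
  d = Num.max 3 (ln (beta * `|ln beta| * Num.sqrt r / 2) / ln beta) ->
  let lam := r `^ (1 / (2 * d)) in
  [/\ beta < lam <= 1, r + (1 - lam) / (lam - beta) * beta <= lam ^+ 2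
    & 1 <= 3 * lam ^+ 2].
Proof.
move=> /andP[b2 b1] /andP[r15 r1] dE lam.
have b0 : 0 < beta by lra.
have r0 : 0 < r by lra.
have d3 : 3 <= d by rewrite dE le_max lexx.
have d0 : 0 < d by lra.
have [delta lE] : exists z, ln beta = - z.
  by exists (- ln beta); rewrite opprK.
have delta0 : 0 < delta by rewrite -oppr_lt0 -lE ln_lt0// b0.
have deltab : delta <= beta^-1 - 1 by have := lnN_le b0; rewrite lE opprK.
have bi2 : beta^-1 <= 2 by rewrite invf_ple ?posrE//; lra.
have sr0 : 0 < Num.sqrt r by rewrite sqrtr_gt0.
have sr1 : Num.sqrt r <= 1 by rewrite -sqrtr1 ler_wsqrtr// ltW.
(* With delta = -ln beta, the second argument of the maximum is 1 - ln(delta sqrt(r)/2)/delta. As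
   delta <= 1/beta - 1 <= 1, the logarithm is at most -ln 2. *)
have kd : 63 / 100 / delta <= d - 1.
  have d2 : ln (beta * `|ln beta| * Num.sqrt r / 2) / ln beta <= d.
    by rewrite dE le_max lexx orbT.
  have nE : `|ln beta| = delta by rewrite lE normrN gtr0_norm.
  rewrite nE -mulrA -mulrA lnM ?posrE ?mulr_gt0 ?invr_gt0// in d2.
  rewrite mulrDl mulfV ?lE ?oppr_eq0 ?gt_eqF// in d2.
  have l2 : ln (delta * (Num.sqrt r / 2)) <= - (63 / 100).
    apply: (@le_trans _ _ (ln (2^-1))); last first.
      by rewrite lnV ?posrE// lerN2 ln2_ge.
    rewrite ler_ln ?posrE ?mulr_gt0 ?invr_gt0// mulrA ler_piMl ?invr_ge0//.
    by rewrite -[leRHS]mul1r; apply: ler_pM; lra.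
  apply: (@le_trans _ _ (ln (delta * (Num.sqrt r / 2)) / - delta)); last lra.
  have -> : ln (delta * (Num.sqrt r / 2)) / - delta =
      - ln (delta * (Num.sqrt r / 2)) / delta by rewrite invrN mulrN mulNr.
  by rewrite ler_pM2r ?invr_gt0//; lra.
pose s := d^-1.
have s0 : 0 < s by rewrite invr_gt0.
have s3 : s <= 1 / 3 by rewrite /s invf_ple ?posrE//; lra.
pose c := 1 - beta.
have c0 : 0 < c by rewrite /c; lra.
have qd : 63 / 100 * beta * s <= c * (1 - s).
  have h : 63 / 100 * beta <= c * (d - 1).
    have h1 : delta * beta <= c.
      have : delta * beta <= (beta^-1 - 1) * beta by rewrite ler_pM2r.
      by rewrite mulrBl mulVf ?gt_eqF// mul1r.
    have h2 : 63 / 100 <= (d - 1) * delta by rewrite -ler_pdivrMr.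
    have h3 : 63 / 100 * beta <= (d - 1) * delta * beta by rewrite ler_pM2r.
    have h4 : (d - 1) * (delta * beta) <= (d - 1) * c by rewrite ler_wpM2l//; lra.
    by rewrite mulrA in h4; lra.
  have := ler_wpM2r (ltW s0) h.
  have -> : c * (d - 1) * s = c * (1 - s) by rewrite /s; field; rewrite gt_eqF.
  by [].
pose y := r^-1 - 1.
have y0 : 0 < y by rewrite subr_gt0 invf_gt1.
have y15 : y <= 1 / 15.
  suff : r^-1 <= 16 / 15 by rewrite /y; lra.
  by rewrite invf_ple ?posrE//; lra.
have lr : - y <= ln r by rewrite lerNl lnN_le.
have rE : r = 1 / (1 + y) by rewrite /y addrC subrK div1r invrK.
have ry : 1 - r = y * r by rewrite /y mulrBl mulVf ?gt_eqF// mul1r.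
have powr_ge p : 0 <= p -> 1 - p * y <= r `^ p.
  move=> p0; rewrite /powR gt_eqF//; apply: le_trans (expR_ge1Dx _).
  by rewrite lerD2l -mulrN ler_wpM2l.
(* A first-order upper bound for 1 - lam, since lam = r^(s/2) and -ln r <= y. *)
pose e := y * s / 2.
have lam1 : 1 - e <= lam.
  have := powr_ge (1 / (2 * d)).
  have -> : 1 / (2 * d) * y = e by rewrite /e /s; field; rewrite gt_eqF.
  by apply; rewrite divr_ge0// mulr_ge0// ltW.
have lam2 : 1 - 2 * e <= lam ^+ 2.
  have -> : lam ^+ 2 = r `^ s.
    rewrite /lam expr2 -powRD; last by rewrite (gt_eqF r0) implybT.
    by congr (_ `^ _); rewrite /s; field; rewrite gt_eqF.
  have := powr_ge s (ltW s0).
  have -> // : s * y = 2 * e by rewrite /e; field.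
have lamle : lam <= 1.
  rewrite /lam -[leRHS](powRr0 r); apply: ger_powR; first by rewrite r0 ltW.
  by rewrite divr_ge0// mulr_ge0// ltW.
have e0 : 0 < e by rewrite /e divr_gt0// mulr_gt0.
have ys : y * s <= 1 / 15 * (1 / 3).
  by apply: ler_pM => //; exact: ltW.
have es : e <= 1 / 90 by rewrite /e; lra.
(* [1 = beta + c] and [qd] bound [e] by a multiple of [c]. *)
have ec : e <= c * (7 / 100).
  have h1 : e * beta <= c * (55 / 1000).
    have : y * (63 / 100 * beta * s) <= 1 / 15 * (c * (1 - s)).
      apply: ler_pM => //; first exact: ltW.
      by rewrite !mulr_ge0// ltW.
    have cs : 0 < c * s by rewrite mulr_gt0.
    have -> : y * (63 / 100 * beta * s) = 126 / 100 * (e * beta).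
      by rewrite /e; field.
    lra.
  have h2 : e * c <= 1 / 90 * c by rewrite ler_pM2r.
  have : e = e * beta + e * c by rewrite /c; ring.
  lra.
have blam : beta < lam by rewrite /c in ec; lra.
split; first by rewrite blam.
(* By 1 - lam <= e, lam - beta >= 0.93 c and lam^2 - r >= y (15/16 - s), it remains to see e beta <=
   0.93 c y (15/16 - s). [qd] gives 1.26 e beta <= c y (1 - s), and this is enough because d >= 3,
   that is s <= 1/3. *)
- have lb0 : 0 < lam - beta by lra.
  have lb : c * (93 / 100) <= lam - beta by rewrite /c in ec *; lra.
  rewrite -lerBrDl mulrAC ler_pdivrMr//.
  apply: (@le_trans _ _ (e * beta)); first by rewrite ler_pM2r//; lra.
  have M : y * (15 / 16 - s) <= lam ^+ 2 - r.
    apply: (@le_trans _ _ (y * r - y * s)).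
      by rewrite -mulrBr ler_pM2l//; lra.
    have -> : y * s = 2 * e by rewrite /e; field.
    lra.
  apply: (@le_trans _ _ (y * (15 / 16 - s) * (c * (93 / 100)))); last first.
    apply: ler_pM => //.
      by rewrite mulr_ge0 ?(ltW y0)//; lra.
    by rewrite mulr_ge0 ?(ltW c0)//; lra.
  have h1 : y * (63 / 100 * beta * s) <= y * (c * (1 - s)) by rewrite ler_pM2l.
  have E : y * (63 / 100 * beta * s) = 126 / 100 * (e * beta).
    by rewrite /e; field.
  have h2 : 0 <= y * c * (1 / 3 - s).
    by rewrite mulr_ge0 ?mulr_ge0 ?(ltW y0) ?(ltW c0)//; lra.
  have h3 : 0 < y * c by rewrite mulr_gt0.
  rewrite E in h1; lra.
- lra.
Qed.

End Exponent.

(** * Contraction of the chain *)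

Section Contraction.
Context {R : realType} d (T : measurableType d) (P : probability T R).
Variables (x b : R) (a : nat -> R) (g : nat -> {RV P >-> R}).
Hypotheses (x0 : 0 < x) (b0 : 0 < b).
Hypothesis a_gt0 : forall i : nat, (1 <= i <= 5)%N -> 0 < a i.
Hypotheses (a14 : 1 < a 1%N + a 4%N) (a25 : 1 < a 2%N + a 5%N)
  (a23 : 1 < a 2%N + a 3%N) (a34 : 1 < a 3%N + a 4%N)
  (a45 : 1 < a 4%N + a 5%N) (a12 : 1 / 3 < a 1%N + a 2%N).
Hypothesis gP : gamma_quadruple a g.
Hypothesis g0 : forall i w, 0 < g i w.

Let gv w : nat -> R := fun i => g i w.
Let step w u := step_map x b (gv w) u.

Let gv0 w : posg (gv w). Proof. by move=> i; exact: g0. Qed.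

Let ap1 : 0 < a 1%N. Proof. exact: a_gt0. Qed.
Let ap2 : 0 < a 2%N. Proof. exact: a_gt0. Qed.
Let ap3 : 0 < a 3%N. Proof. exact: a_gt0. Qed.
Let ap4 : 0 < a 4%N. Proof. exact: a_gt0. Qed.
Let ap5 : 0 < a 5%N. Proof. exact: a_gt0. Qed.

Local Ltac plra :=
  move: x0 b0 a14 a25 a23 a34 a45 a12 ap1 ap2 ap3 ap4 ap5; lra.

(** * Drift of the Lyapunov function *)

Definition lyap (u : R * R) : R := sum2 u + (sum2 u)^-1.

Lemma measurable_step u : measurable_fun setT (fun w => step w u).
Proof. by apply: measurable_step_map. Qed.

Lemma measurable_sum2_step u : measurable_fun setT (fun w => sum2 (step w u)).
Proof.
by apply: measurable_funD; apply: measurableT_comp (measurable_step u).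
Qed.

Lemma sum2_step_gt0 u w : pos2 u -> 0 < sum2 (step w u).
Proof. by move=> u0; apply/sum2_gt0/pos2_step. Qed.

(** Both x + u_2 and S are at most x + S, so the first coordinate is at most (x + S)
    gamma_2/(gamma_1 + gamma_3); the second is at most gamma_4/b. *)
Lemma mean_sum2_step u : pos2 u ->
  mean_le P (fun w => sum2 (step w u)) (zeta1 a * sum2 u + C1 x b a).
Proof.
move=> u0; have S0 := sum2_gt0 u0; have [u1 u2] := u0.
have h1 := mean_le_ratio2 a_gt0 gP g0 (i := 1%N) (j := 3%N) (k := 2%N)
  isT isT isT isT isT isT.
have h4 := mean_le_gshape a_gt0 gP g0 (i := 4%N) isT.
have xS : 0 <= x + sum2 u by rewrite addr_ge0 ?ltW.
have bi : 0 <= b^-1 by rewrite invr_ge0 ltW.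
have s13 : 1 < gshape a 1%N + gshape a 3%N by rewrite /gshape; plra.
apply: mean_le_le (mean_leD (mean_leZ xS (h1 s13)) (mean_leZ bi h4)) _.
- exact: measurable_sum2_step.
- by move=> w; rewrite ltW// sum2_step_gt0.
- move=> w; rewrite /sum2 /step step_mapE/= /gv -/(sum2 u); apply: lerD; last first.
    rewrite mulrC ler_pM2r// lef_pV2 ?posrE//; last exact: (cond2_gt0 b0 (gv0 w)).
    by rewrite /cond2 lerDl ltW// divr_gt0.
  rewrite mulrCA ler_pM2l// -[leRHS]invrK lef_pV2 ?posrE.
  + rewrite invfM invrK /cond1 mulrC mulrDl.
    apply: lerD; rewrite ler_pM2l// lef_pV2 ?posrE ?addr_gt0//.
      by rewrite lerD2l /sum2 lerDl ltW.
    by rewrite lerDr ltW.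
  + exact: (cond1_gt0 x0 (gv0 w)).
  + by rewrite invr_gt0 divr_gt0 ?addr_gt0.
rewrite /C1 /zeta1 /gshape.
rewrite le_eqVlt; apply/orP; left; apply/eqP; field.
by rewrite !gt_eqF//; plra.
Qed.

(** Both denominators of the step map are at most gamma_1/x + gamma_3/S + b. *)
Lemma inv_sum2_step_le u w : pos2 u ->
  (sum2 (step w u))^-1 <= (g 1%N w / x + g 3%N w / sum2 u + b) / (g 2%N w + g 4%N w).
Proof.
move=> u0; have S0 := sum2_gt0 u0; have [u1 u2] := u0.
have c1 := cond1_gt0 x0 (gv0 w) u0; have c2 := cond2_gt0 b0 (gv0 w) u0.
pose m := g 1%N w / x + g 3%N w / sum2 u + b.
have m0 : 0 < m by rewrite !addr_gt0// divr_gt0.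
have m1 : cond1 x (gv w) u <= m.
  rewrite /cond1 /m /gv -addrA; apply: lerD; last by rewrite lerDl ltW.
  by rewrite ler_pM2l// lef_pV2 ?posrE ?addr_gt0// lerDl ltW.
have m2 : cond2 b (gv w) u <= m.
  by rewrite /cond2 /m addrC lerD2r lerDr ltW// divr_gt0.
rewrite -[leRHS]invrK lef_pV2 ?posrE ?sum2_step_gt0//; last first.
  by rewrite invr_gt0 -/m divr_gt0// addr_gt0.
rewrite invfM invrK -/m mulrC mulrDl /sum2 /step step_mapE/=.
by apply: lerD; rewrite ler_pM2l ?gv0// lef_pV2 ?posrE.
Qed.

Lemma mean_inv_sum2_step u : pos2 u ->
  mean_le P (fun w => (sum2 (step w u))^-1) (zeta2 a / sum2 u + C2 x b a).
Proof.
move=> u0; have S0 := sum2_gt0 u0.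
have s24 : 1 < gshape a 2%N + gshape a 4%N by rewrite /gshape; plra.
have h1 := mean_le_ratio2 a_gt0 gP g0 (i := 2%N) (j := 4%N) (k := 1%N)
  isT isT isT isT isT isT s24.
have h3 := mean_le_ratio2 a_gt0 gP g0 (i := 2%N) (j := 4%N) (k := 3%N)
  isT isT isT isT isT isT s24.
have h := mean_le_inv2 gP g0 (i := 2%N) (j := 4%N) isT isT isT s24.
have xi : 0 <= x^-1 by rewrite invr_ge0 ltW.
have Si : 0 <= (sum2 u)^-1 by rewrite invr_ge0 ltW.
apply: mean_le_le (mean_leD (mean_leD (mean_leZ xi h1) (mean_leZ Si h3))
  (mean_leZ (ltW b0) h)) _.
- by apply: measurable_funV; exact: measurable_sum2_step.
- by move=> w; rewrite invr_ge0 ltW// sum2_step_gt0.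
- move=> w; apply: le_trans (inv_sum2_step_le w u0) _.
  rewrite le_eqVlt; apply/orP; left; apply/eqP; field.
  by rewrite !gt_eqF// addr_gt0.
rewrite /C2 /zeta2 /gshape.
rewrite le_eqVlt; apply/orP; left; apply/eqP; field.
by rewrite !gt_eqF//; plra.
Qed.

Let zeta := Num.max (zeta1 a) (zeta2 a).
Let C := C1 x b a + C2 x b a.

(** Once denominators are cleared, [zeta1] < 1 reads 1 < a_1 + a_4, and [zeta2] < 1 reads 1 < a_2 +
    a_5. *)
Lemma zeta_bounds : 0 < zeta < 1.
Proof.
rewrite /zeta lt_max gt_max /zeta1 /zeta2.
rewrite divr_gt0/=; last 2 first; try plra.
by rewrite !ltr_pdivrMr ?mul1r; plra.
Qed.

Lemma C1_gt0 : 0 < C1 x b a.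
Proof.
rewrite /C1 addr_gt0//; last by rewrite divr_gt0//; plra.
by rewrite mulr_gt0// /zeta1 divr_gt0//; plra.
Qed.

Lemma C2_gt0 : 0 < C2 x b a.
Proof.
rewrite /C2 divr_gt0//; last by rewrite mulr_gt0//; plra.
by rewrite addr_gt0 ?mulr_gt0//; plra.
Qed.

Lemma measurable_lyap_step u : measurable_fun setT (fun w => lyap (step w u)).
Proof.
apply: measurable_funD; first exact: measurable_sum2_step.
by apply: measurable_funV; exact: measurable_sum2_step.
Qed.

Lemma lyap_gt0 u : pos2 u -> 0 < lyap u.
Proof. by move=> u0; rewrite addr_gt0 ?invr_gt0// sum2_gt0. Qed.

Lemma mean_lyap_step u : pos2 u ->
  mean_le P (fun w => lyap (step w u)) (zeta * lyap u + C).
Proof.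
move=> u0; have S0 := sum2_gt0 u0.
apply: mean_le_le (mean_leD (mean_sum2_step u0) (mean_inv_sum2_step u0)) _ => //.
- exact: measurable_lyap_step.
- by move=> w; rewrite ltW// lyap_gt0//; exact: pos2_step.
rewrite /C /lyap.
have h1 : zeta1 a * sum2 u <= zeta * sum2 u.
  by rewrite ler_pM2r// le_max lexx.
have h2 : zeta2 a / sum2 u <= zeta / sum2 u.
  by rewrite ler_pM2r ?invr_gt0// le_max lexx orbT.
by rewrite (mulrDr zeta) addrACA lerD2r lerD.
Qed.

Let asum := a 2%N + a 3%N + a 4%N + a 5%N.

Lemma asum_gt0 : 0 < asum.
Proof. by rewrite !addr_gt0// a_gt0. Qed.

Lemma kern_lower (f : R * R -> \bar R) l r u :
  measurable_fun setT f -> (forall z, 0 <= f z)%E ->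
  pos2 l -> 1 <= r -> between l r u ->
  ((r `^ (- asum))%:E * kern g x b f l <= kern g x b f u)%E.
Proof.
move=> mf f0 l0 r1 lu; have u0 := pos2_between l0 lu.
have r0 : 0 < r by rewrite (lt_le_trans _ r1).
pose k1 (v : R * R) (y1 y3 : R) := y1 / (x + v.1) + y3 / sum2 v.
pose k2 (v : R * R) (y3 : R) := b + y3 / sum2 v.
have mk1 v d1 (S : measurableType d1) (p q : S -> R) :
    measurable_fun setT p -> measurable_fun setT q ->
    measurable_fun setT (fun y => k1 v (p y) (q y)).
  by move=> mp mq; apply: measurable_funD; exact: measurable_funM.
have mk2 v d1 (S : measurableType d1) (q : S -> R) :
    measurable_fun setT q -> measurable_fun setT (fun y => k2 v (q y)).
  by move=> mq; apply: measurable_funD => //; exact: measurable_funM.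
have cr w : cfac x b (gv w) l <= 1 by exact: cfac_le1.
have rc w : 1 + (r - 1) * cfac x b (gv w) l <= r.
  have : (r - 1) * cfac x b (gv w) l <= (r - 1) * 1.
    by rewrite ler_wpM2l// subr_ge0.
  by rewrite mulr1; lra.
have c1 w : 1 <= cond1 x (gv w) l / cond1 x (gv w) u <= r.
  have p1 := cond1_gt0 x0 (gv0 w) u0.
  rewrite ler_pdivlMr// mul1r (cond1_anti x0 (gv0 w) l0 lu)/= ler_pdivrMr//.
  rewrite (le_trans (cond1_lower x0 b0 (gv0 w) l0 r1 lu))//.
  by rewrite ler_wpM2r// ltW.
have c2 w : 1 <= cond2 b (gv w) l / cond2 b (gv w) u <= r.
  have p2 := cond2_gt0 b0 (gv0 w) u0.
  rewrite ler_pdivlMr// mul1r (cond2_anti b (gv0 w) l0 lu)/= ler_pdivrMr//.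
  rewrite (le_trans (cond2_lower x0 b0 (gv0 w) l0 r1 lu))//.
  by rewrite ler_wpM2r// ltW.
have -> : - asum = - gshape a 2%N + - gshape a 4%N.
  by rewrite /asum /gshape; ring.
rewrite powRD; last by rewrite (gt_eqF r0) implybT.
rewrite EFinM -muleA.
have s2 : 0 <= gshape a 2%N by rewrite ltW// gshape_gt0.
have s4 : 0 <= gshape a 4%N by rewrite ltW// gshape_gt0.
(* Replacing cond1 and cond2 at l by their values at u amounts to dilating
   gamma_2 and gamma_4, one after the other, by factors in [1, r]. *)
pose F1 (z : R * R * R * R) :=
  f (z.1.2 / k1 l z.1.1.1 z.1.1.2, z.2 / k2 l z.1.1.2).
pose F2 (z : R * R * R * R) :=
  f (z.2 / k1 l z.1.1.1 z.1.1.2, z.1.2 / k2 u z.1.1.2).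
have q1 : measurable_fun setT (fun z : R * R * R * R => z.1) by exact: measurable_fst.
have q11 : measurable_fun setT (fun z : R * R * R * R => z.1.1).
  exact: measurableT_comp measurable_fst q1.
have q111 : measurable_fun setT (fun z : R * R * R * R => z.1.1.1).
  exact: measurableT_comp measurable_fst q11.
have q112 : measurable_fun setT (fun z : R * R * R * R => z.1.1.2).
  exact: measurableT_comp measurable_snd q11.
have q12 : measurable_fun setT (fun z : R * R * R * R => z.1.2).
  exact: measurableT_comp measurable_snd q1.
have mF1 : measurable_fun setT F1.
  apply: measurableT_comp => //; apply: measurable_fun_pair;
    apply: measurable_funM => //; apply: measurable_funV;
    [exact: mk1|exact: mk2].
have mF2 : measurable_fun setT F2.
  apply: measurableT_comp => //; apply: measurable_fun_pair;
    apply: measurable_funM => //; apply: measurable_funV;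
    [exact: mk1|exact: mk2].
have t1 : measurable_fun setT (fun z : R * R * R => z.1) by exact: measurable_fst.
have t11 : measurable_fun setT (fun z : R * R * R => z.1.1).
  exact: measurableT_comp measurable_fst t1.
have t12 : measurable_fun setT (fun z : R * R * R => z.1.2).
  exact: measurableT_comp measurable_snd t1.
pose e1 (y : R * R * R) := k1 l y.1.1 y.1.2 / k1 u y.1.1 y.1.2.
pose e2 (y : R * R * R) := k2 l y.1.2 / k2 u y.1.2.
have me1 : measurable_fun setT e1.
  by apply: measurable_funM; [|apply: measurable_funV]; exact: mk1.
have me2 : measurable_fun setT e2.
  by apply: measurable_funM; [|apply: measurable_funV]; exact: mk2.
have mY j k m : measurable_fun setT (fun w => (g j w, g k w, g m w)).
  by do 2 apply: measurable_fun_pair => //.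
have h4 := @integral_scale_ge _ _ _ P _ g _ _ _ (fun w => (g 1%N w, g 3%N w, g 2%N w))
  4%N (gshape a 4%N) (mY _ _ _)
  (@quadruple_indep3 _ _ _ _ _ _ gP 1%N 3%N 2%N isT isT isT isT isT isT) isT
  (quadruple_scaling gP (i := 4%N) isT) e2 r F1 me2 c2 s4 (g0 4%N) mF1 (fun z => f0 _).
have h2 := @integral_scale_ge _ _ _ P _ g _ _ _ (fun w => (g 1%N w, g 3%N w, g 4%N w))
  2%N (gshape a 2%N) (mY _ _ _)
  (@quadruple_indep3 _ _ _ _ _ _ gP 1%N 3%N 4%N isT isT isT isT isT isT) isT
  (quadruple_scaling gP (i := 2%N) isT) e1 r F2 me1 c1 s2 (g0 2%N) mF2 (fun z => f0 _).
(* After the dilation of gamma_4 the second coordinate is the one issued from u while the first is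
   still issued from l: this hybrid [F2] is the start of the second dilation. *)
have E4 : (\int[P]_w F1 (g 1%N w, g 3%N w, g 2%N w,
      (e2 (g 1%N w, g 3%N w, g 2%N w) * g 4%N w)%R) =
    \int[P]_w F2 (g 1%N w, g 3%N w, g 4%N w, g 2%N w))%E.
  apply: eq_integral => w _; rewrite /F1 /F2 /e2 /=; congr (f (_, _)).
  have := cond2_gt0 b0 (gv0 w) l0; have := cond2_gt0 b0 (gv0 w) u0.
  rewrite /cond2 -/(k2 u (g 3%N w)) -/(k2 l (g 3%N w)) => q2u q2l.
  by field; rewrite !gt_eqF.
have E2 : (\int[P]_w F2 (g 1%N w, g 3%N w, g 4%N w,
      (e1 (g 1%N w, g 3%N w, g 4%N w) * g 2%N w)%R) = kern g x b f u)%E.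
  apply: eq_integral => w _; rewrite /F2 /e1 /=; congr (f (_, _)).
  have := cond1_gt0 x0 (gv0 w) l0; have := cond1_gt0 x0 (gv0 w) u0.
  rewrite /cond1 -/(k1 u (g 1%N w) (g 3%N w)) -/(k1 l (g 1%N w) (g 3%N w)) => q2u q2l.
  by field; rewrite !gt_eqF.
rewrite E4 in h4; rewrite E2 in h2.
by apply: le_trans h2; rewrite lee_wpmul2l ?lee_fin ?powR_ge0.
Qed.

(** [kern_lower] is used for f at v and for 1 - f at u. The two contributions of l add up to
    r^(-asum), leaving a difference of at most 1 - r^(-asum) <= asum (r - 1). *)
Lemma kern_base (f : R * R -> \bar R) l r u v :
  measurable_fun setT f -> (forall z, 0 <= f z <= 1)%E ->
  pos2 l -> 1 <= r -> between l r u -> between l r v ->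
  (kern g x b f u <= kern g x b f v + (asum * (r - 1))%:E)%E.
Proof.
move=> mf f01 l0 r1 lu lv.
have r0 : 0 < r by rewrite (lt_le_trans _ r1).
have f0 z : (0 <= f z)%E by have /andP[] := f01 z.
have f1 z : (f z <= 1)%E by have /andP[] := f01 z.
have ff z : f z \is a fin_num by rewrite ge0_fin_numE// (le_lt_trans (f1 z))// ltry.
pose f' z := (1 - f z)%E.
have mf' : measurable_fun setT f' by exact: emeasurable_funB.
have f'0 z : (0 <= f' z)%E by rewrite sube_ge0 ?ff ?orbT.
have mstep z : measurable_fun setT (fun w => step w z).
  by apply: measurable_step_map.
have one z : (kern g x b f z + kern g x b f' z = 1)%E.
  rewrite -ge0_integralD//; last 2 first.
  - by apply: measurableT_comp => //; exact: mstep.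
  - by apply: measurableT_comp => //; exact: mstep.
  rewrite -[RHS](integral_cst_probability P); apply: eq_integral => w _.
  by rewrite /f' addeC subeK.
have k0 z h : (forall y, 0 <= h y)%E -> (0 <= kern g x b h z)%E.
  by move=> h0; exact: kern_ge0.
have fink z : exists2 p : R, (kern g x b f z = p%:E)%E &
    (kern g x b f' z = (1 - p)%:E)%E /\ 0 <= p <= 1.
  have := one z; have := k0 z f f0; have := k0 z f' f'0.
  case: (kern g x b f z) => [p| |]; case: (kern g x b f' z) => [q| |]//.
  rewrite !lee_fin => q0 p0 [pq]; exists p => //; split; last by lra.
  by congr EFin; lra.
have := kern_lower mf' f'0 l0 r1 lu; have := kern_lower mf f0 l0 r1 lv.
have [p -> [-> p01]] := fink u; have [q -> [_ q01]] := fink v.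
have [s -> [-> s01]] := fink l.
rewrite -!EFinM -EFinD !lee_fin.
set k := r `^ (- asum).
have k1 : 1 - asum * (r - 1) <= k.
  move: r1; rewrite le_eqVlt => /predU1P[e1|r1].
    by rewrite /k -e1 subrr mulr0 subr0 powR1.
  have := @powRN_ge _ asum (r - 1) (ltW asum_gt0); rewrite subr_gt0 => /(_ r1).
  by have -> : 1 + (r - 1) = r by ring.
have : 0 <= k by exact: powR_ge0.
move=> k00 h1 h2.
have : k * (1 - s) = k - k * s by rewrite mulrBr mulr1.
by move=> E; move: h1 h2 k1; rewrite E; lra.
Qed.

(** * Mean of the contraction factor *)

Let E3 := a 3%N + a 4%N.
Let s1 := a 1%N + a 2%N.
Let rho := varrho a.

Local Lemma E3_gt1 : 1 < E3. Proof. exact: a34. Qed.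
Local Lemma s1_gt : 1 / 3 < s1. Proof. exact: a12. Qed.

Local Lemma rho_gt0 : 0 < rho.
Proof.
by rewrite /rho /varrho divr_gt0 ?mulr_gt0 ?subr_gt0// (lt_trans ltr01).
Qed.

(* The mean of [cfac] at u is at most 1 - 1 / cden u, and the mean of cden after
   one step is at most eta (theta1 + theta2) + theta3. *)
Definition cden (u : R * R) : R :=
  (rho + 4) / x * sum2 u + 4 * ((rho + 4) * x + 4 * E3 / b) / sum2 u.

(** y + 4/y >= 4 with y = S/x. The value 16 is the source of the bound 15/16 <= r required by
    [exponent_bounds]. *)
Lemma cden_ge16 u : pos2 u -> 16 <= cden u.
Proof.
move=> u0; have S0 := sum2_gt0 u0.
have r0 := rho_gt0; have e3 := E3_gt1.
pose y := sum2 u / x.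
have y0 : 0 < y by rewrite divr_gt0.
have -> : cden u = (rho + 4) * (y + 4 / y) + 16 * E3 / (b * sum2 u).
  by rewrite /cden /y; field; rewrite !gt_eqF.
have h : 4 <= y + 4 / y.
  rewrite -subr_ge0.
  have -> : y + 4 / y - 4 = (y - 2) ^+ 2 / y by field; rewrite gt_eqF.
  by rewrite divr_ge0 ?sqr_ge0 ?ltW.
have h2 : 0 <= 16 * E3 / (b * sum2 u).
  by rewrite divr_ge0 ?mulr_ge0 ?(ltW b0) ?(ltW S0)//; lra.
have h3 : 0 <= rho * (y + 4 / y).
  by rewrite mulr_ge0 ?(ltW r0)//; lra.
by rewrite mulrDl; lra.
Qed.

(* The tangent of 1/X at a well chosen point turns the size-biased mean of
   gamma_1 / (A gamma_1 + B) into first and second moments; this replaces the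
   median bound behind varrho. *)
Definition tang (u : R * R) : R :=
  (1 + u.1 / x + E3 / (b * sum2 u)) * (s1 + 1) +
  (x + u.1) ^+ 2 / (x * sum2 u) * E3.

Lemma tang_gt0 u : pos2 u -> 0 < tang u.
Proof.
move=> u0; have S0 := sum2_gt0 u0; have [u1 u2] := u0.
have e3 := E3_gt1; have s13 := s1_gt.
have xu : 0 < x + u.1 by rewrite addr_gt0.
have e30 : 0 < E3 by lra.
have s10 : 0 < s1 + 1 by lra.
rewrite /tang addr_gt0// mulr_gt0// ?divr_gt0 ?mulr_gt0 ?exprn_gt0//.
by rewrite !addr_gt0 ?divr_gt0 ?mulr_gt0.
Qed.

Lemma tang_le u : pos2 u -> tang u / s1 <= cden u.
Proof.
move=> u0; have S0 := sum2_gt0 u0; have [u1 u2] := u0.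
have e3 := E3_gt1; have s13 := s1_gt; have r0 := rho_gt0.
have s10 : 0 < s1 by lra.
pose y := sum2 u / x.
have y0 : 0 < y by rewrite divr_gt0.
pose D := E3 / (b * sum2 u).
have D0 : 0 < D by rewrite divr_gt0 ?mulr_gt0//; lra.
pose e := 1 + s1^-1.
have e4 : e <= 4.
  suff : s1^-1 <= 3 by rewrite /e; lra.
  by rewrite invf_ple ?posrE//; lra.
have e0 : 1 < e by rewrite /e ltrDl invr_gt0.
have cE : cden u = (rho + 4) * (y + 4 / y) + 16 * D.
  by rewrite /cden /y /D; field; rewrite !gt_eqF.
pose q := u.1 / x.
have q0 : 0 < q by rewrite divr_gt0.
have qy : q <= y by rewrite ler_pM2r ?invr_gt0// /sum2 lerDl ltW.
have tE : tang u / s1 = (1 + q) * e + D * e + (1 + q) ^+ 2 / y * (E3 / s1).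
  by rewrite /tang /q /y /D /e; field; rewrite !gt_eqF.
have rE : E3 / s1 <= rho / 4.
  have -> : rho / 4 = E3 / (s1 - 1 / 3).
    rewrite /rho /varrho -/E3 -/s1; field; rewrite gt_eqF//; lra.
  rewrite ler_pM2l ?lef_pV2 ?posrE//; lra.
have yi0 : 0 < y^-1 by rewrite invr_gt0.
have yy : 2 <= y + y^-1.
  rewrite -subr_ge0.
  have -> : y + y^-1 - 2 = (y - 1) ^+ 2 / y by field; rewrite gt_eqF.
  by rewrite divr_ge0 ?sqr_ge0 ?ltW.
have p1 : (1 + q) ^+ 2 / y <= 2 * (y + y^-1).
  apply: (@le_trans _ _ ((1 + y) ^+ 2 / y)).
    rewrite ler_pM2r// !expr2; apply: ler_pM; lra.
  have -> : (1 + y) ^+ 2 / y = y + y^-1 + 2 by field; rewrite gt_eqF.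
  lra.
have p2 : (1 + q) ^+ 2 / y * (E3 / s1) <= 2 * (y + y^-1) * (rho / 4).
  apply: ler_pM => //.
    by rewrite divr_ge0 ?sqr_ge0 ?ltW.
  by rewrite divr_ge0 ?ltW//; lra.
have p3 : D * e <= D * 4 by rewrite ler_pM2l.
have p4 : q * e <= y * 4 by apply: ler_pM; lra.
have rr : rho * 2 <= rho * (y + y^-1) by rewrite ler_pM2l.
have ri : 0 < rho * y^-1 by rewrite mulr_gt0.
have p5 : e <= 4 / y + rho + 4.
  have h4 : 0 < 4 / y by rewrite mulr_gt0.
  lra.
(* If e <= 2, the terms with coefficient 4 absorb (1 + q) e. Otherwise s1 < 1, which forces rho >=
   4, and the rho terms pay for the larger e. *)
have [e2|e2] := lerP e 2.
  have p6 : q * e <= 2 * y by rewrite mulrC; apply: ler_pM; lra.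
  have hh : (1 + q) * e <= 4 * (y + 4 / y) by rewrite mulrDl mul1r; lra.
  rewrite tE cE; lra.
have s11 : s1 < 1.
  move: e2; rewrite /e => e2.
  by rewrite -[s1]invrK invf_lt1 ?invr_gt0//; lra.
have rho4 : 4 <= rho.
  rewrite /rho /varrho -/E3 -/s1 ler_pdivlMr; lra.
rewrite tE cE; lra.
Qed.

Lemma cfac_tangent u w : pos2 u ->
  cfac x b (gv w) u + 2 / tang u * g 1%N w <=
  1 + (tang u)^-2 * ((1 + u.1 / x) * g 1%N w ^+ 2 +
    (b * sum2 u)^-1 * (g 1%N w ^+ 2 * g 3%N w) +
    (x + u.1) ^+ 2 / (x * sum2 u) * (g 1%N w * g 3%N w)).
Proof.
move=> u0; have K0 := tang_gt0 u0; set K := tang u in K0 *.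
have S0 := sum2_gt0 u0; have [u1 u2] := u0.
have g1 : 0 < g 1%N w by []; have g3 : 0 < g 3%N w by [].
have D1 : 0 < cfac_den x b (gv w) u.
  by rewrite (lt_le_trans _ (cfac_den_ge1 x0 b0 (gv0 w) u0)).
set X := cfac_den x b (gv w) u in D1.
have YE : (1 + u.1 / x) * g 1%N w ^+ 2 +
    (b * sum2 u)^-1 * (g 1%N w ^+ 2 * g 3%N w) +
    (x + u.1) ^+ 2 / (x * sum2 u) * (g 1%N w * g 3%N w) = g 1%N w ^+ 2 * X.
  by rewrite /X /cfac_den /gv; field; rewrite !gt_eqF.
rewrite YE /cfac -/X -subr_ge0.
(* This is 1/X >= 2 c - c^2 X with c = gamma_1/K. The factor gamma_1^2 clears the inverse of gamma_1
   hidden in X. *)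
have -> : 1 + K^-2 * (g 1%N w ^+ 2 * X) - (1 - X^-1 + 2 / K * g 1%N w) =
    X^-1 * (1 - g 1%N w * X / K) ^+ 2.
  by field; rewrite !gt_eqF.
by rewrite mulr_ge0 ?sqr_ge0// invr_ge0 ltW.
Qed.

Lemma measurable_cfac u : measurable_fun setT (fun w => cfac x b (gv w) u).
Proof.
apply: measurable_funB => //; apply: measurable_funV.
apply: measurable_funD; last exact: measurable_funM.
apply: measurable_funD => //; apply: measurable_funM => //.
by apply: measurable_funM => //; apply: measurable_funV.
Qed.

(** [tang u] equals E[gamma_1^2 cfac_den]/s1, so the mean of the tangent bound is 1 - s1/[tang u];
    [tang_le] then compares it with [cden]. *)
Lemma mean_cfac u : pos2 u ->
  mean_le P (fun w => cfac x b (gv w) u) (1 - (cden u)^-1).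
Proof.
move=> u0; have K0 := tang_gt0 u0.
have S0 := sum2_gt0 u0; have [u1 u2] := u0.
have e3 := E3_gt1; have s13 := s1_gt.
have s10 : 0 < s1 by lra.
have m11 := mean_le_sqr a_gt0 gP g0 (i := 1%N) isT.
have m1 := mean_le_gshape a_gt0 gP g0 (i := 1%N) isT.
have m3 := mean_le_gshape a_gt0 gP g0 (i := 3%N) isT.
have mn := @normr_measurable R setT.
have nE i w : `|g i w| = g i w by rewrite gtr0_norm.
have absE i : (fun w => `|g i w|) = g i by apply/funext => w; exact: nE.
have m3' : mean_le P (fun w => `|g 3%N w|) (gshape a 3%N) by rewrite absE.
have m113 : mean_le P (fun w => g 1%N w ^+ 2 * g 3%N w)
    ((gshape a 1%N + 1) * gshape a 1%N * gshape a 3%N).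
  have := mean_le_prod gP (i := 1%N) (k := 3%N) (h := fun z => z ^+ 2)
    (f := fun z => `|z|) isT isT isT _ mn (fun z => sqr_ge0 z) _ m11 m3'.
  have -> : (fun w => g 1%N w ^+ 2 * `|g 3%N w|) =
      (fun w => g 1%N w ^+ 2 * g 3%N w) by apply/funext => w; rewrite nE.
  by apply => //; exact: exprn_measurable.
have m13 : mean_le P (fun w => g 1%N w * g 3%N w) (gshape a 1%N * gshape a 3%N).
  have m1' : mean_le P (fun w => `|g 1%N w|) (gshape a 1%N) by rewrite absE.
  have := mean_le_prod gP (i := 1%N) (k := 3%N) (h := fun z => `|z|)
    (f := fun z => `|z|) isT isT isT mn mn _ _ m1' m3'.
  have -> : (fun w => `|g 1%N w| * `|g 3%N w|) =
      (fun w => g 1%N w * g 3%N w) by apply/funext => w; rewrite !nE.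
  exact.
have c1 : 0 <= 1 + u.1 / x by rewrite addr_ge0// divr_ge0// ltW.
have c2 : 0 <= (b * sum2 u)^-1 by rewrite invr_ge0 mulr_ge0// ltW.
have c3 : 0 <= (x + u.1) ^+ 2 / (x * sum2 u).
  by rewrite divr_ge0 ?sqr_ge0// mulr_ge0// ltW.
have K2 : 0 <= (tang u)^-2 by rewrite invr_ge0 exprn_ge0// ltW.
have H := mean_leD (mean_le_cst P (k := 1) ler01) (mean_leZ K2
  (mean_leD (mean_leD (mean_leZ c1 m11) (mean_leZ c2 m113)) (mean_leZ c3 m13))).
have c0 w : 0 <= cfac x b (gv w) u by exact: cfac_ge0.
have k2 : 0 <= 2 / tang u by rewrite divr_ge0// ltW.
have Ht : mean_le P (fun w => cfac x b (gv w) u + 2 / tang u * g 1%N w)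
    (1 + s1 / tang u).
  apply: mean_le_le (fun w => cfac_tangent w u0) H _.
  - by apply: measurable_funD; [exact: measurable_cfac|exact: measurable_funM].
  - by move=> w; rewrite addr_ge0// mulr_ge0// ltW.
  rewrite le_eqVlt; apply/orP; left; apply/eqP; congr (1 + _).
  transitivity ((tang u)^-2 * (s1 * tang u)).
    congr (_ * _); rewrite /tang /gshape -/s1 -/E3.
    by field; rewrite !gt_eqF.
  by field; rewrite gt_eqF.
have mean2 : (\int[P]_w (2 / tang u * g 1%N w)%:E = (2 / tang u * s1)%:E)%E.
  rewrite integral_EFinZ//; last by move=> w; exact: ltW.
  by rewrite (gshape_mean a_gt0 gP g0).
have := mean_le_sub (measurable_cfac u) c0 _ _ mean2 Ht.
have c16 := cden_ge16 u0.
case=> [||mc _ Hc].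
- exact: measurable_funM.
- by move=> w; rewrite mulr_ge0// ltW.
split => //; apply: (le_trans Hc).
have h : (cden u)^-1 <= s1 / tang u.
  rewrite -[leRHS]invf_div lef_pV2 ?posrE ?divr_gt0//; last by lra.
  exact: tang_le.
rewrite lee_fin mulrAC -mulrA; move: h; lra.
Qed.

Let L := (rho + 4) * x + 4 * E3 / b.
Let f2 w := (2 + g 2%N w / g 4%N w + g 4%N w / g 2%N w) *
  (g 3%N w / (g 2%N w + g 4%N w)).
Let f3 w := (2 + g 2%N w / g 4%N w + g 4%N w / g 2%N w) *
  ((g 1%N w / x + b) / (g 2%N w + g 4%N w)).

Local Lemma s2_gt1 : 1 < gshape a 2%N. Proof. exact: a23. Qed.
Local Lemma s4_gt1 : 1 < gshape a 4%N. Proof. exact: a45. Qed.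

Local Lemma mweight :
  measurable_fun setT (fun w => 2 + g 2%N w / g 4%N w + g 4%N w / g 2%N w).
Proof.
apply: measurable_funD; last by apply: measurable_funM => //; exact: measurable_funV.
apply: measurable_funD => //.
by apply: measurable_funM => //; exact: measurable_funV.
Qed.

Local Lemma weight_gt0 w : 0 < 2 + g 2%N w / g 4%N w + g 4%N w / g 2%N w.
Proof. by rewrite !addr_gt0 ?divr_gt0. Qed.

(** The weight is (g_2 + g_4)^2/(g_2 g_4), so [f2] is g_3/g_2 + g_3/g_4. Its mean is finite because
    the shapes of g_2 and g_4 exceed 1. *)
Local Lemma mean_f2 : mean_le P f2 (fine 'E_P[f2]).
Proof.
have h2 := mean_le_ratio a_gt0 gP g0 (i := 2%N) (k := 3%N) isT isT isT s2_gt1.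
have h4 := mean_le_ratio a_gt0 gP g0 (i := 4%N) (k := 3%N) isT isT isT s4_gt1.
rewrite unlock; apply: mean_le_fine.
apply: mean_le_le (mean_leD h2 h4) (lexx _).
- apply: measurable_funM; first exact: mweight.
  by apply: measurable_funM => //; apply: measurable_funV; exact: measurable_funD.
- by move=> w; rewrite mulr_ge0 ?(ltW (weight_gt0 _))// divr_ge0 ?addr_ge0// ltW.
move=> w; rewrite /f2 le_eqVlt; apply/orP; left; apply/eqP; field.
by rewrite !gt_eqF// addr_gt0.
Qed.

Local Lemma mean_f3 : mean_le P f3 (fine 'E_P[f3]).
Proof.
have h2 := mean_le_ratio a_gt0 gP g0 (i := 2%N) (k := 1%N) isT isT isT s2_gt1.
have h4 := mean_le_ratio a_gt0 gP g0 (i := 4%N) (k := 1%N) isT isT isT s4_gt1.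
have i2 := mean_le_inv gP g0 (i := 2%N) isT s2_gt1.
have i4 := mean_le_inv gP g0 (i := 4%N) isT s4_gt1.
have xi : 0 <= x^-1 by rewrite invr_ge0 ltW.
rewrite unlock; apply: mean_le_fine.
apply: mean_le_le (mean_leD (mean_leZ xi (mean_leD h2 h4))
  (mean_leZ (ltW b0) (mean_leD i2 i4))) (lexx _).
- apply: measurable_funM; first exact: mweight.
  apply: measurable_funM; last by apply: measurable_funV; exact: measurable_funD.
  by apply: measurable_funD => //; exact: measurable_funM.
- move=> w; rewrite mulr_ge0 ?(ltW (weight_gt0 _))//.
  by rewrite divr_ge0 ?addr_ge0 ?divr_ge0// ltW.
move=> w; rewrite /f3 le_eqVlt; apply/orP; left; apply/eqP; field.
by rewrite !gt_eqF// addr_gt0.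
Qed.

Let Zc := eta_const x b a * (theta1 x a + theta2 x b a g) + theta3 x b a g.

(** The factor 4 in [cden] is bounded by the weight 2 + g_2/g_4 + g_4/g_2, which produces the
    integrands of [theta2] and [theta3]. On the set V <= eta, both S and 1/S are at most eta. *)
Lemma mean_cden_step u : pos2 u -> lyap u <= eta_const x b a ->
  mean_le P (fun w => cden (step w u)) Zc.
Proof.
move=> u0 good; have S0 := sum2_gt0 u0.
have r0 := rho_gt0; have e3 := E3_gt1.
have e30 : 0 < E3 by exact: lt_trans e3.
have L0 : 0 < L.
  by rewrite /L; apply: addr_gt0; [apply: mulr_gt0 => //; exact: addr_gt0|
    apply: divr_gt0 => //; exact: mulr_gt0].
have r4 : 0 <= (rho + 4) / x by rewrite divr_ge0 ?(ltW x0)//; lra.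
have Si : 0 <= (sum2 u)^-1 by rewrite invr_ge0 ltW.
have mS := mean_sum2_step u0.
have m2 := mean_f2; have m3 := mean_f3.
have H := mean_leD (mean_leZ r4 mS)
  (mean_leZ (ltW L0) (mean_leD (mean_leZ Si m2) m3)).
have mst := measurable_sum2_step u.
apply: mean_le_le H _.
- apply: measurable_funD; apply: measurable_funM => //.
  exact: measurable_funV.
- move=> w; have := cden_ge16 (pos2_step x0 b0 (gv0 w) u0).
  by rewrite -/(step w u); lra.
- move=> w; rewrite /cden lerD2l -/L [4 * L]mulrC -mulrA ler_pM2l//.
  have := inv_sum2_step_le w u0; rewrite -/(step w u) => h.
  apply: (@le_trans _ _ (4 * ((g 1%N w / x + g 3%N w / sum2 u + b) /
    (g 2%N w + g 4%N w)))); first by rewrite ler_pM2l.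
  have g2 : 0 < g 2%N w by []. have g4 : 0 < g 4%N w by [].
  have -> : (sum2 u)^-1 * f2 w + f3 w =
      (2 + g 2%N w / g 4%N w + g 4%N w / g 2%N w) *
      ((g 1%N w / x + g 3%N w / sum2 u + b) / (g 2%N w + g 4%N w)).
    by rewrite /f2 /f3; field; rewrite !gt_eqF// addr_gt0.
  rewrite ler_wpM2r//.
    by rewrite ltW// divr_gt0 ?addr_gt0 ?divr_gt0.
  rewrite -subr_ge0.
  have -> : 2 + g 2%N w / g 4%N w + g 4%N w / g 2%N w - 4 =
      (g 2%N w - g 4%N w) ^+ 2 / (g 2%N w * g 4%N w).
    by field; rewrite !gt_eqF.
  by rewrite divr_ge0 ?sqr_ge0// ltW// mulr_gt0.
have S_eta : sum2 u <= eta_const x b a.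
  by apply: le_trans good; rewrite /lyap lerDl.
have Si_eta : (sum2 u)^-1 <= eta_const x b a.
  by apply: le_trans good; rewrite /lyap lerDr ltW.
set t2 := fine _ in m2 *; set t3 := fine _ in m3 *.
have t20 : 0 <= t2 := mean_le_ge0 m2.
have E : Zc = eta_const x b a * theta1 x a + eta_const x b a * (L * t2) +
    ((rho + 4) / x * C1 x b a + L * t3).
  rewrite /Zc /theta2 /theta3 -/rho -/E3 -/t2 -/t3 -/L -/(C1 x b a).
  by rewrite mulrDr div1r [x^-1 * _]mulrC.
have z1 : 0 <= zeta1 a.
  by rewrite /zeta1; apply: divr_ge0; plra.
have th1 : 0 <= theta1 x a.
  by rewrite /theta1 -/rho div1r [x^-1 * _]mulrC mulr_ge0.
have e1 : sum2 u * theta1 x a <= eta_const x b a * theta1 x a.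
  by rewrite ler_wpM2r.
have e2 : (sum2 u)^-1 * (L * t2) <= eta_const x b a * (L * t2).
  by rewrite ler_wpM2r// mulr_ge0// ltW.
rewrite E.
have -> : (rho + 4) / x * (zeta1 a * sum2 u + C1 x b a) +
    L * ((sum2 u)^-1 * t2 + t3) = sum2 u * theta1 x a + (sum2 u)^-1 * (L * t2) +
    ((rho + 4) / x * C1 x b a + L * t3).
  by rewrite /theta1 -/rho; ring.
by rewrite !lerD.
Qed.

Lemma rate_den_ge16 u : pos2 u -> lyap u <= eta_const x b a -> 16 <= Zc.
Proof.
move=> u0 good; apply: (mean_le_const (P := P)).
apply: mean_le_le (mean_cden_step u0 good) (lexx _) => // w.
by apply: cden_ge16; exact: pos2_step.
Qed.

(** Jensen's inequality for z -> 1 - 1/z, obtained from its tangent at [Zc]. *)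
Lemma mean_rate u : pos2 u -> lyap u <= eta_const x b a ->
  mean_le P (fun w => 1 - (cden (step w u))^-1) (rate x b a g).
Proof.
move=> u0 good; have Z16 := rate_den_ge16 u0 good.
have Z0 : 0 < Zc by lra.
have c16 w : 16 <= cden (step w u).
  by apply: cden_ge16; exact: pos2_step.
have [mc _ _] := mean_cden_step u0 good.
have K2 : 0 <= Zc^-2 by rewrite invr_ge0 exprn_ge0// ltW.
have H := mean_leD (mean_le_cst P (k := 1) ler01)
  (mean_leZ K2 (mean_cden_step u0 good)).
have f0 w : 0 <= 1 - (cden (step w u))^-1.
  by rewrite subr_ge0 invf_le1; have := c16 w; lra.
have mf : measurable_fun setT (fun w => 1 - (cden (step w u))^-1).
  by apply: measurable_funB => //; exact: measurable_funV.
have k0 : 0 <= 2 / Zc by rewrite divr_ge0// ltW.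
have Hs : mean_le P (fun w => 1 - (cden (step w u))^-1 + 2 / Zc) (1 + Zc^-1).
  apply: mean_le_le H _.
  - exact: measurable_funD.
  - by move=> w; rewrite addr_ge0.
  - move=> w; have c0 : 0 < cden (step w u) by have := c16 w; lra.
    rewrite -subr_ge0.
    have -> : 1 + Zc^-2 * cden (step w u) -
        (1 - (cden (step w u))^-1 + 2 / Zc) =
        (cden (step w u))^-1 * (1 - cden (step w u) / Zc) ^+ 2.
      by field; rewrite !gt_eqF.
    by rewrite mulr_ge0 ?sqr_ge0// invr_ge0 ltW.
  rewrite lerD2l le_eqVlt; apply/orP; left; apply/eqP.
  by field; rewrite gt_eqF.
have [_ _ h] := mean_le_sub mf f0 (measurable_cst (2 / Zc)) (fun=> k0)
  (integral_cst_probability P (2 / Zc)%:E) Hs.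
split => //; apply: (le_trans h).
by rewrite lee_fin /rate -/Zc div1r mulrDl; lra.
Qed.


Let eta := eta_const x b a.
Let beta := beta_const a.

Local Lemma eta_gt0 : 0 < eta.
Proof.
have := C1_gt0; have := C2_gt0; have /andP[z0 z1] := zeta_bounds.
rewrite /eta /eta_const -/zeta => c2 c1.
by apply: divr_gt0; [apply: mulr_gt0 => //; exact: addr_gt0|rewrite subr_gt0].
Qed.

(** This is C = (beta - zeta) eta, the choice of eta that turns zeta v + C into at most beta max(v,
    eta). *)
Local Lemma C_eta : C = eta * (1 - zeta) / 2.
Proof.
have /andP[z0 z1] := zeta_bounds.
have h : 1 - zeta != 0 by rewrite subr_eq0 gt_eqF.
by rewrite /eta /eta_const -/zeta -/C; field.
Qed.

Local Lemma beta_bounds : 1 / 2 <= beta < 1.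
Proof.
have /andP[z0 z1] := zeta_bounds; rewrite /beta /beta_const -/zeta.
by move: z0 z1; move: zeta => z z0 z1; apply/andP; split; lra.
Qed.

Local Lemma drift_good v : v <= eta -> zeta * v + C <= beta * eta.
Proof.
move=> ve; have /andP[z0 _] := zeta_bounds.
have : zeta * v <= zeta * eta by rewrite ler_pM2l.
rewrite C_eta /beta /beta_const -/zeta.
by move: zeta eta => z e; lra.
Qed.

Local Lemma drift_bad v : eta <= v -> zeta * v + C <= beta * v.
Proof.
move=> ev; have /andP[_ z1] := zeta_bounds.
have : (1 - zeta) * eta <= (1 - zeta) * v by rewrite ler_pM2l// subr_gt0.
rewrite C_eta /beta /beta_const -/zeta.
by move: zeta eta => z e; lra.
Qed.

(** * Iterating the contraction along the lower state *)

Section Closeness.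
Variable f : R * R -> \bar R.
Hypotheses (mf : measurable_fun setT f) (f01 : forall z, (0 <= f z <= 1)%E).

Let K n := iter n (kern g x b) f.

Local Lemma f_ge0 z : (0 <= f z)%E. Proof. by have /andP[] := f01 z. Qed.

Local Lemma measurable_K n : measurable_fun setT (K n).
Proof. by have [] := iter_kern_measurable g x b n mf f_ge0. Qed.

Local Lemma K_ge0 n z : (0 <= K n z)%E.
Proof. exact: (iter_kern_measurable g x b n mf f_ge0).2. Qed.

Local Lemma K_le1 n z : (K n z <= 1)%E.
Proof.
elim: n z => [|n ih] z; first by have /andP[] := f01 z.
rewrite -(integral_cst_probability P 1%E); apply: ge0_le_integral => //.
- by move=> w _; exact: K_ge0.
- exact: measurableT_comp (measurable_K n) (measurable_step z).
Qed.

Lemma K_step n u v (phi : T -> R) c :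
  (forall w, (K n (step w u) <= K n (step w v) + (phi w)%:E)%E) ->
  mean_le P phi c -> (K n.+1 u <= K n.+1 v + c%:E)%E.
Proof.
move=> h [mphi phi0 phic].
have mKs z : measurable_fun setT (fun w => K n (step w z)).
  exact: measurableT_comp (measurable_K n) (measurable_step z).
have mphiE : measurable_fun setT (fun w => (phi w)%:E) by exact/measurable_EFinP.
apply: (@le_trans _ _ (\int[P]_w (K n (step w v) + (phi w)%:E))%E).
  apply: ge0_le_integral => //.
  - by move=> w _; exact: K_ge0.
  - exact: mKs.
  - exact: emeasurable_funD.
  - by move=> w _; exact: h.
rewrite ge0_integralD//.
- by rewrite leeD.
- by move=> w _; exact: K_ge0.
- by move=> w _; rewrite lee_fin.
Qed.

(** [k] is the fraction of the one-step bound asum (r - 1) left after n steps. It depends on the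
    lower state only, and one inequality suffices since u and v can be exchanged. *)
Definition close n l (k : R) := forall r u v, 1 <= r ->
  between l r u -> between l r v ->
  (K n u <= K n v + (asum * (r - 1) * k)%:E)%E.

Lemma close_le n l k k' : k <= k' -> close n l k -> close n l k'.
Proof.
move=> kk h r u v r1 lu lv; apply: le_trans (h r u v r1 lu lv) _.
rewrite leeD2l// lee_fin ler_wpM2l// mulr_ge0 ?subr_ge0//.
exact: ltW asum_gt0.
Qed.

Lemma close1 l : pos2 l -> close 1 l 1.
Proof.
by move=> l0 r u v r1 lu lv; rewrite mulr1; exact: (kern_base mf f01 l0 r1 lu lv).
Qed.

Lemma close_step n l (k : R * R -> R) c : pos2 l ->
  (forall w, close n (step w l) (k (step w l))) ->
  mean_le P (fun w => cfac x b (gv w) l * k (step w l)) c ->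
  close n.+1 l c.
Proof.
move=> l0 h m r u v r1 lu lv.
have A0 : 0 <= asum * (r - 1).
  by rewrite mulr_ge0 ?subr_ge0//; exact: ltW asum_gt0.
apply: (K_step _ (mean_leZ A0 m)) => w.
have r10 : 0 <= r - 1 by rewrite subr_ge0.
have c0 := cfac_ge0 x0 b0 (gv0 w) l0.
have r1' : 1 <= 1 + (r - 1) * cfac x b (gv w) l.
  by rewrite lerDl mulr_ge0.
have := h w _ _ _ r1' (between_step x0 b0 (gv0 w) l0 r1 lu)
  (between_step x0 b0 (gv0 w) l0 r1 lv).
by rewrite addrAC subrr add0r !mulrA.
Qed.

Local Lemma mean_cfac_mul l (k : R * R -> R) c : pos2 l ->
  measurable_fun setT (fun w => k (step w l)) ->
  (forall w, 0 <= k (step w l)) ->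
  mean_le P (fun w => k (step w l)) c ->
  mean_le P (fun w => cfac x b (gv w) l * k (step w l)) c.
Proof.
move=> l0 mk k0 m; apply: mean_le_le m (lexx c).
- by apply: measurable_funM => //; exact: measurable_cfac.
- by move=> w; rewrite mulr_ge0//; exact: (cfac_ge0 x0 b0).
- by move=> w; rewrite ler_piMl//; exact: (cfac_le1 x0 b0).
Qed.

Section Geometric.
Variables (lam al : R).
Hypotheses (lam_gt0 : 0 < lam) (lam_le1 : lam <= 1) (al_ge0 : 0 <= al).
Hypothesis lam_bad : 1 - lam <= al * (lam - beta).
Hypothesis lam_good : rate x b a g + al * beta <= lam ^+ 2.

Let good l := lyap l <= eta.
(** The shift makes A 0 >= 1 and A 1 = 1, so the one-step bound starts the induction at both
    indices. *)
Let A n : R := lam ^+ n / lam.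
(* Off the set lyap <= eta the weight shrinks by lam on average, and al * beta
   bounds the mean excess weight after two steps started in this set. *)
Let wt l : R := 1 + al * (lyap l / eta).

Local Lemma A_gt0 n : 0 < A n. Proof. by rewrite divr_gt0// exprn_gt0. Qed.

Local Lemma AS n : A n.+1 = A n * lam.
Proof. by rewrite /A exprSr mulrAC. Qed.

Local Lemma wt_ge1 l : pos2 l -> 1 <= wt l.
Proof.
move=> l0; rewrite /wt lerDl mulr_ge0// divr_ge0//.
  by rewrite ltW// lyap_gt0.
exact: ltW eta_gt0.
Qed.

Local Lemma mean_wt_step l : pos2 l ->
  mean_le P (fun w => wt (step w l)) (1 + al * ((zeta * lyap l + C) / eta)).
Proof.
move=> l0; have e0 := eta_gt0.
have ae : 0 <= al / eta by rewrite divr_ge0// ltW.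
have := mean_leD (mean_le_cst P (k := 1) ler01)
  (mean_leZ ae (mean_lyap_step l0)).
rewrite mulrAC -mulrA; congr (mean_le P _ _).
by apply/funext => w; rewrite /wt mulrAC -mulrA.
Qed.

(** Here the factor c is only bounded by 1. With v = V/eta >= 1, [lam_bad] yields 1 + al beta v <=
    lam (1 + al v). *)
Local Lemma close_all_step n l : pos2 l -> eta <= lyap l ->
  (forall u, pos2 u -> close n.+1 u (A n * wt u)) ->
  close n.+2 l (A n.+1 * wt l).
Proof.
move=> l0 bad h; have e0 := eta_gt0.
have v1 : 1 <= lyap l / eta by rewrite ler_pdivlMr// mul1r.
have An := A_gt0 n.
apply: (@close_step n.+1 l (fun u => A n * wt u)) => //.
  by move=> w; apply: h; exact: pos2_step.
apply: (mean_cfac_mul (k := fun u => A n * wt u)) => //.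
- have [mw _ _] := mean_wt_step l0; exact: measurable_funM.
- move=> w; rewrite mulr_ge0 ?(ltW An)// (le_trans ler01)// wt_ge1//.
  exact: pos2_step.
have [mw w0 wle] := mean_leZ (ltW An) (mean_wt_step l0).
split => //; apply: (le_trans wle); rewrite lee_fin AS -mulrA ler_pM2l//.
have h1 : al * ((zeta * lyap l + C) / eta) <= al * (beta * (lyap l / eta)).
  by rewrite ler_wpM2l// mulrA ler_pM2r ?invr_gt0//; exact: drift_bad.
have h2 : (1 - lam) * 1 <= al * (lam - beta) * (lyap l / eta).
  by apply: ler_pM => //; rewrite subr_ge0.
move: h1 h2; rewrite /wt; move: (lyap l / eta) ((_ + C) / eta) => v z h1 h2.
by move: h1 h2; move: lam al beta => lm am be; lra.
Qed.

(** The first factor is bounded by 1. The second has conditional mean 1 - 1/[cden], whose average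
    over the first step is at most the rate; two drift steps bound the excess weight by al beta. *)
Local Lemma close_good_step2 n l : pos2 l -> good l ->
  (forall u, pos2 u -> close n.+1 u (A n * wt u)) ->
  close n.+3 l (A n.+2).
Proof.
move=> l0 gl h; have e0 := eta_gt0; have An := A_gt0 n.
have /andP[z0 z1] := zeta_bounds.
have /andP[b20 b1] := beta_bounds.
pose k1 u := A n * (1 - (cden u)^-1 + al / eta * (zeta * lyap u + C)).
have ae : 0 <= al / eta by rewrite divr_ge0// ltW.
have C0 : 0 <= C by rewrite /C addr_ge0// ltW ?C1_gt0// C2_gt0.
have k1close u : pos2 u -> close n.+2 u (k1 u).
  move=> u0; apply: (@close_step n.+1 u (fun v => A n * wt v)) => //.
    by move=> w; apply: h; exact: pos2_step.
  have m := mean_leZ (ltW An) (mean_leD (mean_cfac u0)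
    (mean_leZ ae (mean_lyap_step u0))).
  apply: mean_le_le m (lexx _).
  - apply: measurable_funM; first exact: measurable_cfac.
    have [mw _ _] := mean_wt_step u0; exact: measurable_funM.
  - move=> w; rewrite mulr_ge0 ?(cfac_ge0 x0 b0)// mulr_ge0 ?(ltW An)//.
    by rewrite (le_trans ler01)// wt_ge1//; exact: pos2_step.
  move=> w; rewrite mulrCA ler_pM2l// /wt mulrDr mulr1 lerD2l.
  have v0 := pos2_step x0 b0 (gv0 w) u0; have Lv0 := lyap_gt0 v0.
  rewrite -/(step w u) in v0 Lv0 *.
  have -> : al * (lyap (step w u) / eta) = al / eta * lyap (step w u) by ring.
  by rewrite ler_piMl ?(cfac_le1 x0 b0)// mulr_ge0// ltW.
apply: (@close_step n.+2 l k1) => //.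
  by move=> w; apply: k1close; exact: pos2_step.
have Lg : al / eta * (zeta * (zeta * lyap l + C) + C) <= al * beta.
  rewrite mulrAC -mulrA ler_wpM2l// ler_pdivrMr//.
  have d1 := drift_good gl.
  have d2 : zeta * lyap l + C <= eta.
    by apply: le_trans d1 _; rewrite ler_piMl ?ltW.
  exact: drift_good.
have m := mean_leZ (ltW An) (mean_leD (mean_rate l0 gl) (mean_leZ ae
  (mean_leD (mean_leZ (ltW z0) (mean_lyap_step l0)) (mean_le_cst P C0)))).
have [mk kk0 _] := m.
apply: (mean_cfac_mul (k := k1)) => //.
apply: mean_le_le m _ => //.
rewrite !AS -mulrA ler_pM2l// -expr2; apply: le_trans lam_good.
by rewrite lerD2l.
Qed.

(** The bound on good states advances by two steps, so two consecutive indices are carried, together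
    with the weighted bound valid everywhere. *)
Lemma close_geometric n :
  [/\ forall l, pos2 l -> good l -> close n.+1 l (A n),
      forall l, pos2 l -> good l -> close n.+2 l (A n.+1)
    & forall l, pos2 l -> close n.+1 l (A n * wt l)].
Proof.
have A01 : 1 <= A 0 by rewrite /A expr0 ler_pdivlMr// mul1r.
have A11 : A 1 = 1 by rewrite /A expr1 mulfV// gt_eqF.
suff H m : [/\ forall l, pos2 l -> good l -> close m.+1 l (A m),
      forall l, pos2 l -> good l -> close m.+2 l (A m.+1)
    & forall l, pos2 l -> close m.+1 l (A m * wt l)] by exact: H.
elim: m => [|m [g1 g2 all]]; split.
- by move=> l l0 _; apply: close_le (close1 l0).
- move=> l l0 _; rewrite A11.
  apply: (@close_step 1 l (fun=> 1)) => //.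
    by move=> w; apply: close1; exact: pos2_step.
  apply: (mean_cfac_mul (k := fun=> 1)) => //.
  exact: mean_le_cst.
- move=> l l0; apply: close_le (close1 l0).
  by rewrite -[leLHS]mulr1; apply: ler_pM => //; exact: wt_ge1.
- exact: g2.
- move=> l l0 gl.
  exact: (close_good_step2 l0 gl all).
- move=> l l0; have [gl|bl] := lerP (lyap l) eta.
    apply: close_le (g2 l l0 gl).
    by rewrite ler_peMr ?(ltW (A_gt0 _))// wt_ge1.
  apply: close_all_step => //; exact: ltW.
Qed.

End Geometric.

Let r := rate x b a g.
Let dd := dconst x b a g.

Local Lemma rate_bounds l : pos2 l -> lyap l <= eta -> 15 / 16 <= r < 1.
Proof.
move=> l0 gl; have Z16 := rate_den_ge16 l0 gl.
have Z0 : 0 < Zc by apply: lt_le_trans Z16.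
rewrite /r /rate -/Zc; apply/andP; split; last first.
  by rewrite ltrBlDr ltrDl divr_gt0.
have : 1 / Zc <= 1 / 16 by rewrite !div1r lef_pV2 ?posrE.
by move: (1 / Zc) => z; lra.
Qed.

Lemma close_good n l : pos2 l -> lyap l <= eta ->
  close n.+1 l (3 * r `^ (n.+1%:R / (2 * dd))).
Proof.
move=> l0 gl; have r15 := rate_bounds l0 gl.
have /andP[rl r1] := r15.
have r0 : 0 < r by apply: lt_le_trans rl.
have := exponent_bounds beta_bounds r15 (erefl dd).
set lam := _ `^ _; move=> /= [/andP[bl l1] lg l3].
have /andP[bg _] := beta_bounds.
have lb : 0 < lam - beta by rewrite subr_gt0.
have lam0 : 0 < lam by apply: lt_trans bl; apply: lt_le_trans bg.
have al0 : 0 <= (1 - lam) / (lam - beta) by rewrite divr_ge0 ?subr_ge0// ltW.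
have lbad : 1 - lam <= (1 - lam) / (lam - beta) * (lam - beta).
  by rewrite divfK// gt_eqF.
have [h _ _] := close_geometric lam0 l1 al0 lbad lg n.
(* The constant 3 pays for the shift in [A]: lam^(n-1) <= 3 lam^(n+1), because 1 <= 3 lam^2. *)
apply: close_le (h l l0 gl).
have -> : r `^ (n.+1%:R / (2 * dd)) = lam ^+ n.+1.
  rewrite /lam -powR_mulrn ?powR_ge0// -powRrM.
  by congr (_ `^ _); rewrite mulrC div1r.
rewrite ler_pdivrMr// exprSr -mulrA -mulrA -expr2 mulrCA.
by rewrite ler_peMr// exprn_ge0// ltW.
Qed.

(** As long as V > eta, each step multiplies the mean of V by at most beta. Once V <= eta, at least
    N steps remain and [h] applies; if the k steps run out first, V/eta > 1 covers the trivial bound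
    1. *)
Lemma close_general N k X l q u v : 0 <= X ->
  (forall n z, (N <= n)%N -> pos2 z -> lyap z <= eta -> close n z X) ->
  pos2 l -> 1 <= q -> between l q u -> between l q v ->
  (K (N + k) u <= K (N + k) v +
    (asum * (q - 1) * X + beta ^+ k * (lyap l / eta))%:E)%E.
Proof.
move=> X0 h; have e0 := eta_gt0.
have /andP[bg b1] := beta_bounds.
have b00 : 0 <= beta by apply: le_trans bg.
have A0 : 0 <= asum by exact: ltW asum_gt0.
elim: k l q u v => [|k ih] l q u v l0 q1 lu lv.
  have AX : 0 <= asum * (q - 1) * X by rewrite !mulr_ge0// subr_ge0.
  have [gl|bl] := lerP (lyap l) eta.
    apply: le_trans (h (N + 0)%N l _ l0 gl q u v q1 lu lv) _.
      by rewrite addn0.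
    by rewrite leeD2l// lee_fin lerDl mul1r divr_ge0// ltW// lyap_gt0.
  apply: le_trans (K_le1 _ _) _.
  rewrite -[leLHS]add0e leeD ?K_ge0// lee_fin.
  by rewrite expr0 mul1r -[leLHS]add0r lerD// ler_pdivlMr// mul1r ltW.
have [gl|bl] := lerP (lyap l) eta.
  apply: le_trans (h (N + k.+1)%N l (leq_addr _ _) l0 gl q u v q1 lu lv) _.
  rewrite leeD2l// lee_fin lerDl mulr_ge0 ?exprn_ge0//.
  by rewrite divr_ge0// ltW// lyap_gt0.
have q10 : 0 <= q - 1 by rewrite subr_ge0.
have AX : 0 <= asum * (q - 1) * X by rewrite !mulr_ge0.
have bk : 0 <= beta ^+ k / eta by rewrite divr_ge0 ?exprn_ge0// ltW.
have m := mean_leD (mean_le_cst P AX) (mean_leZ bk (mean_lyap_step l0)).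
rewrite addnS; apply: le_trans (K_step (v := v) _ m) _.
  move=> w; have c0 := cfac_ge0 x0 b0 (gv0 w) l0.
  have q1' : 1 <= 1 + (q - 1) * cfac x b (gv w) l by rewrite lerDl mulr_ge0.
  apply: le_trans (ih _ _ _ _ (pos2_step x0 b0 (gv0 w) l0) q1'
    (between_step x0 b0 (gv0 w) l0 q1 lu) (between_step x0 b0 (gv0 w) l0 q1 lv)) _.
  rewrite leeD2l// lee_fin; apply: lerD.
    rewrite addrAC subrr add0r ler_wpM2r// ler_wpM2l// ler_piMr//.
    exact: (cfac_le1 x0 b0).
  by rewrite -/(step w l) mulrA mulrAC.
rewrite leeD2l// lee_fin lerD2l exprSr.
rewrite mulrAC -mulrA -mulrA ler_wpM2l ?exprn_ge0//.
by rewrite mulrA ler_pM2r ?invr_gt0//; apply: drift_bad; exact: ltW.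
Qed.

Local Lemma dconst_gt0 : 0 < dd.
Proof. by rewrite /dd /dconst lt_max ltr0n. Qed.

Lemma kern_good_bound t l q u v : pos2 l -> lyap l <= eta -> 1 <= q ->
  between l q u -> between l q v ->
  (K (t + 3) u <= K (t + 3) v +
    (3 * r `^ (t%:R / (2 * dd)) * asum * (q - 1))%:E)%E.
Proof.
move=> l0 gl q1 lu lv; have /andP[rl r1] := rate_bounds l0 gl.
have r0 : 0 < r by apply: lt_le_trans rl.
rewrite addn3; apply: le_trans (close_good t.+2 l0 gl q1 lu lv) _.
have A0 : 0 <= asum * (q - 1) by rewrite mulr_ge0 ?subr_ge0//; exact: ltW asum_gt0.
rewrite leeD2l// lee_fin.
rewrite [leRHS](_ : _ = asum * (q - 1) * (3 * r `^ (t%:R / (2 * dd)))); last by ring.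
rewrite ler_wpM2l// ler_pM2l//; apply: ger_powR; first by rewrite r0 ltW.
by rewrite ler_pM2r ?ler_nat ?invr_gt0 ?mulr_gt0 ?dconst_gt0// -addn3 leq_addr.
Qed.

Lemma kern_general_bound t l q u v : (0 < t)%N -> pos2 l -> 1 <= q ->
  between l q u -> between l q v ->
  (K (t + 3) u <= K (t + 3) v +
    (3 * r `^ (t%:R / (4 * dd)) * asum * (q - 1) +
     Num.max (lyap l) eta / eta * beta ^+ (t./2 + 3))%:E)%E.
Proof.
move=> t0 l0 q1 lu lv; have d0 := dconst_gt0; have e0 := eta_gt0.
(* N steps are kept for the contraction and t/2 + 3 (halves rounded down) for reaching V <= eta. As
   2 N >= t, the exponent N/(2d) is at least t/(4d); t > 0 ensures N >= 1, where [close_good]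
   starts. *)
pose N := (t - t./2)%N; pose X := 3 * r `^ (t%:R / (4 * dd)).
have tE : (t = N + t./2)%N.
  rewrite subnK//.
  by rewrite -[leqRHS](odd_double_half t) -addnn addnA leq_addl.
have tN : (t <= N + N)%N.
  rewrite {1}tE leq_add2l -(leq_add2r t./2) -tE addnn.
  by rewrite -[leqRHS](odd_double_half t) leq_addl.
have N0 : (0 < N)%N by have := leq_trans t0 tN; rewrite addn_gt0 orbb.
have X0 : 0 <= X by rewrite mulr_ge0 ?powR_ge0.
have h n z : (N <= n)%N -> pos2 z -> lyap z <= eta -> close n z X.
  move=> Nn z0 gz; have n0 := leq_trans N0 Nn.
  have /andP[rl r1] := rate_bounds z0 gz.
  have r0 : 0 < r by apply: lt_le_trans rl.
  have := close_good n.-1 z0 gz; rewrite (prednK n0); apply: close_le.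
  rewrite ler_pM2l//; apply: ger_powR; first by rewrite r0 ltW.
  rewrite ler_pdivrMr ?mulr_gt0//.
  have -> : n%:R / (2 * dd) * (4 * dd) = (n + n)%:R :> R.
    by rewrite natrD; field; rewrite gt_eqF.
  by rewrite ler_nat (leq_trans tN)// leq_add.
have := close_general (t./2 + 3) X0 h l0 q1 lu lv.
rewrite addnA -tE => /le_trans; apply.
rewrite leeD2l// lee_fin; apply: lerD.
  by rewrite /X mulrC mulrA.
rewrite mulrC ler_wpM2r ?exprn_ge0//.
  by have /andP[bg _] := beta_bounds; apply: le_trans bg.
by rewrite ler_pM2r ?invr_gt0// le_max lexx.
Qed.

Lemma K_dist n u v e : (K n u <= K n v + e%:E)%E -> (K n v <= K n u + e%:E)%E ->
  (`|K n u - K n v| <= e%:E)%E.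
Proof.
have := K_ge0 n u; have := K_le1 n u; have := K_ge0 n v; have := K_le1 n v.
case: (K n u) => [p| |]//; case: (K n v) => [q| |]// _ _ _ _.
rewrite -!EFinD !lee_fin => pq qp.
by rewrite ler_norml; apply/andP; split; lra.
Qed.

End Closeness.

End Contraction.

(** * Positive version of the noise *)

Section PositiveVersion.
Context {R : realType} d (T : measurableType d) (P : probability T R).
Variables (a : nat -> R) (g : nat -> {RV P >-> R}).
Hypothesis gP : gamma_quadruple a g.

(** A Gamma variable is positive only almost surely, whereas the pathwise bounds are used at every
    point; the value 1 fills the null set. *)
Let clip (z : R) : R := if 0 < z then z else 1.

Local Lemma measurable_clip : measurable_fun setT clip.
Proof. by apply: measurable_fun_ifT => //; exact: measurable_fun_ltr. Qed.

Local Lemma gamma_clip_ae i : (1 <= i <= 4)%N ->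
  {ae P, forall w, g i w = clip (g i w)}.
Proof.
move=> i14; exists (g i @^-1` `]-oo, 0]%classic); split.
- by apply: measurable_funPTI.
- have := gP.1 i i14 `]-oo, 0]%classic (measurable_itv _).
  rewrite /distribution /pushforward => ->.
  rewrite integral0_eq// => z /=; rewrite in_itv/= => z0.
  by rewrite /gamma_pdf ltNge z0.
- move=> w /= h; rewrite in_itv/= leNgt; apply/negP => w0; apply: h.
  by rewrite /clip w0.
Qed.

Lemma positive_version : exists g' : nat -> {RV P >-> R},
  [/\ gamma_quadruple a g', forall i w, 0 < g' i w
    & forall i, (1 <= i <= 4)%N -> {ae P, forall w, g i w = g' i w}].
Proof.
have mclip i : measurable_fun setT (fun w => clip (g i w)).
  exact: measurableT_comp measurable_clip _.
pose g' i : {RV P >-> R} := HB.pack (fun w => clip (g i w))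
  (isMeasurableFun.Build _ _ _ _ _ (mclip i)).
have mpre (A : set R) : measurable A -> measurable (clip @^-1` A).
  by move=> mA; rewrite -[X in measurable X]setTI; exact: measurable_clip.
exists g'; split.
- split=> [i i14 A mA|s A us sD mA]; last first.
    exact: (gP.2 s (fun i => clip @^-1` A i) us sD (fun i => mpre _ (mA i))).
  have := gP.1 i i14 _ (mpre A mA).
  rewrite {1}/distribution {1}/pushforward.
  rewrite -[LHS]/(distribution P (g' i) A) => ->.
  rewrite integral_mkcond [RHS]integral_mkcond; apply: eq_integral => z _.
  rewrite !patchE; have [z0|z0] := ltP 0 z.
    have -> // : (z \in clip @^-1` A) = (z \in A).
    by apply/idP/idP; rewrite !inE /= /clip z0.
  have -> : (gamma_pdf (a i + a i.+1) 1 z) = 0 by rewrite /gamma_pdf ltNge z0.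
  by rewrite !if_same.
- by move=> i w; rewrite /= /clip; case: ifPn.
- exact: gamma_clip_ae.
Qed.

Lemma rate_ae (x b : R) (g' : nat -> {RV P >-> R}) :
  (forall i, (1 <= i <= 4)%N -> {ae P, forall w, g i w = g' i w}) ->
  rate x b a g = rate x b a g'.
Proof.
move=> gg'.
have ae : {ae P, forall w, (g 1%N w = g' 1%N w /\ g 2%N w = g' 2%N w) /\
    (g 3%N w = g' 3%N w /\ g 4%N w = g' 4%N w)}.
  apply: filterS (filterI (filterI (gg' 1%N isT) (gg' 2%N isT))
    (filterI (gg' 3%N isT) (gg' 4%N isT))) => w.
  by [].
have mw (h : nat -> {RV P >-> R}) : measurable_fun setT
    (fun w => 2 + h 2%N w / h 4%N w + h 4%N w / h 2%N w).
  apply: measurable_funD; last by apply: measurable_funM => //; exact: measurable_funV.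
  apply: measurable_funD => //.
  by apply: measurable_funM => //; exact: measurable_funV.
have mS (h : nat -> {RV P >-> R}) : measurable_fun setT
    (fun w => (h 2%N w + h 4%N w)^-1).
  by apply: measurable_funV; exact: measurable_funD.
have th2 : fine 'E_P[fun w => (2 + g 2%N w / g 4%N w + g 4%N w / g 2%N w) *
      (g 3%N w / (g 2%N w + g 4%N w))] =
    fine 'E_P[fun w => (2 + g' 2%N w / g' 4%N w + g' 4%N w / g' 2%N w) *
      (g' 3%N w / (g' 2%N w + g' 4%N w))].
  rewrite unlock; congr fine; apply: ae_eq_integral => //.
  + by apply/measurable_EFinP; do 2 apply: measurable_funM => //.
  + by apply/measurable_EFinP; do 2 apply: measurable_funM => //.
  + by apply: filterS ae => w [[e1 e2] [e3 e4]] _; rewrite e2 e3 e4.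
have th3 : fine 'E_P[fun w => (2 + g 2%N w / g 4%N w + g 4%N w / g 2%N w) *
      ((g 1%N w / x + b) / (g 2%N w + g 4%N w))] =
    fine 'E_P[fun w => (2 + g' 2%N w / g' 4%N w + g' 4%N w / g' 2%N w) *
      ((g' 1%N w / x + b) / (g' 2%N w + g' 4%N w))].
  rewrite unlock; congr fine; apply: ae_eq_integral => //.
  + apply/measurable_EFinP; do 2 apply: measurable_funM => //.
    by apply: measurable_funD => //; exact: measurable_funM.
  + apply/measurable_EFinP; do 2 apply: measurable_funM => //.
    by apply: measurable_funD => //; exact: measurable_funM.
  + by apply: filterS ae => w [[e1 e2] [e3 e4]] _; rewrite e1 e2 e4.
by rewrite /rate /theta2 /theta3 th2 th3.
Qed.

End PositiveVersion.

Theorem theorem2 (R : realType) (x b : R) (a : nat -> R)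
  (x_gt0 : 0 < x) (b_gt0 : 0 < b)
  (a_gt0 : forall i : nat, (1 <= i <= 5)%N -> 0 < a i)
  (a14 : 1 < a 1%N + a 4%N) (a25 : 1 < a 2%N + a 5%N) (a23 : 1 < a 2%N + a 3%N)
  (a34 : 1 < a 3%N + a 4%N) (a45 : 1 < a 4%N + a 5%N)
  (a12 : 1 / 3 < a 1%N + a 2%N)
  (* the variables gamma_1, ..., gamma_4 entering the constants *)
  (d0 : measure_display) (T0 : measurableType d0) (P0 : probability T0 R)
  (g : nat -> {RV P0 >-> R}) (gP : gamma_quadruple a g)
  (* the two copies of the chain, each on its own probability space *)
  (u0 w0 : R * R)
  (u02_gt0 : 0 < u0.1) (u04_gt0 : 0 < u0.2)
  (w02_gt0 : 0 < w0.1) (w04_gt0 : 0 < w0.2)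
  (d1 : measure_display) (T1 : measurableType d1) (P1 : probability T1 R)
  (gU : nat -> nat -> {RV P1 >-> R}) (gUP : gamma_noise a gU)
  (U : nat -> {RV P1 >-> (R * R)%type}) (UP : is_chain x b gU u0 U)
  (d2 : measure_display) (T2 : measurableType d2) (P2 : probability T2 R)
  (gW : nat -> nat -> {RV P2 >-> R}) (gWP : gamma_noise a gW)
  (W : nat -> {RV P2 >-> (R * R)%type}) (WP : is_chain x b gW w0 W) :
  let M := Num.max (Num.max u0.1 u0.2) (Num.max w0.1 w0.2) in
  let m := Num.min (Num.min u0.1 u0.2) (Num.min w0.1 w0.2) in
  let R0 := M / m in
  let J0 := 2 * m + 1 / (2 * m) in
  let eta := eta_const x b a in
  let beta := beta_const a in
  let r := rate x b a g in
  let d := dconst x b a g in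
  let asum := a 2%N + a 3%N + a 4%N + a 5%N in
  (J0 <= eta -> forall t : nat, (0 < t)%N ->
    (dTV (distribution P1 (U (t + 3)%N)) (distribution P2 (W (t + 3)%N)) <=
      (3 * r `^ (t%:R / (2 * d)) * asum * (R0 - 1))%:E)%E) /\
  (forall t : nat, (0 < t)%N ->
    (dTV (distribution P1 (U (t + 3)%N)) (distribution P2 (W (t + 3)%N)) <=
      (3 * r `^ (t%:R / (4 * d)) * asum * (R0 - 1) +
       Num.max J0 eta / eta * beta ^+ (t./2 + 3))%:E)%E).
Proof.
move=> M m R0 J0 eta beta r d asum.
(* Only the quadruple realising the kernel is modified; the noise of the two chains enters through
   its law alone. *)
have [g' [g'P g'0 gg']] := positive_version gP.
have rE : r = rate x b a g' := rate_ae a x b gg'.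
have dE : d = dconst x b a g' by rewrite /d /dconst (rate_ae a x b gg').
(* This lower state has V(l) = J0, and R0 l = (M, M) dominates both starting points. *)
pose l := (m, m).
have m0 : 0 < m by rewrite !lt_min u02_gt0 u04_gt0 w02_gt0 w04_gt0.
have l0 : pos2 l by [].
have lJ : lyap l = J0 by rewrite /lyap /J0 /sum2 /= -mulr2n mulr_natl div1r.
have R0m : R0 * m = M by rewrite divfK// gt_eqF.
have [mu1 mu2] : m <= u0.1 /\ m <= u0.2.
  by rewrite !ge_min !lexx ?orbT.
have [mw1 mw2] : m <= w0.1 /\ m <= w0.2.
  by rewrite !ge_min !lexx ?orbT.
have [Mu1 Mu2] : u0.1 <= M /\ u0.2 <= M.
  by rewrite !le_max !lexx ?orbT.
have [Mw1 Mw2] : w0.1 <= M /\ w0.2 <= M.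
  by rewrite !le_max !lexx ?orbT.
have R1 : 1 <= R0 by rewrite ler_pdivlMr// mul1r (le_trans mu1).
have lu : between l R0 u0 by rewrite /between /= R0m mu1 mu2 Mu1 Mu2.
have lw : between l R0 w0 by rewrite /between /= R0m mw1 mw2 Mw1 Mw2.
have mI (A : set (R * R)) : measurable A ->
    measurable_fun setT (EFin \o (\1_A : R * R -> R)).
  by move=> mA; exact/measurable_EFinP.
have I01 (A : set (R * R)) z : (0 <= (EFin \o (\1_A : R * R -> R)) z <= 1)%E.
  by rewrite /= !lee_fin indicE; case: (_ \in _); rewrite ?lexx ler01.
rewrite rE dE; split=> [gJ|] t t0; apply: ge_ereal_sup => _ [A mA <-];
  rewrite (distribution_chain g'P gUP UP)// (distribution_chain g'P gWP WP)//;
  have mIA := mI A mA; have IA01 := I01 A.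
- rewrite -lJ in gJ.
  by apply: (K_dist mIA IA01);
    apply: (kern_good_bound x_gt0 b_gt0 a_gt0 a14 a25 a23 a34 a45 a12 g'P g'0
      mIA IA01 _ l0 gJ R1).
- rewrite -lJ.
  by apply: (K_dist mIA IA01);
    apply: (kern_general_bound x_gt0 b_gt0 a_gt0 a14 a25 a23 a34 a45 a12 g'P g'0
      mIA IA01 t0 l0 R1).
Qed.
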